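(* Let $5 \le d \le q$ and let $N_3$ denote the maximum of $|\mathcal{C}(\mathbb{F}_q)|$ over all projective plane curves $\mathcal{C}$ of degree $d$ defined over $\mathbb{F}_q$ satisfying $|\mathcal{C}(\mathbb{F}_q)| < dq - d + 3$. Then $N_3 = dq + 1 - 2(d-3)$ if $d \le \frac{q+5}{2}$, and $N_3 \le (d-1)q + 2$ if $d \ge \frac{q+6}{2}$.
   Context: $\mathbb{F}_q$ is the finite field with $q$ elements. A projective plane curve of degree $d$ defined over $\mathbb{F}_q$ is the zero set in $\mathbb{P}^2$ of a nonzero homogeneous polynomial of degree $d$ in three variables over $\mathbb{F}_q$; $\mathcal{C}(\mathbb{F}_q)$ denotes its set of $\mathbb{F}_q$-rational points. (For $3\le d\le q$ the largest possible value of $|\mathcal{C}(\mathbb{F}_q)|$ is $dq+1$ and the second largest is $dq-d+3$, so $N_3$ is the third largest value.) *)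

(* Defs.v *)
From HB Require Import structures.
From mathcomp Require Import all_boot all_order all_algebra all_field.
From mathcomp Require Import mpoly.
Set Implicit Arguments. Unset Strict Implicit. Unset Printing Implicit Defensive.
Import GRing.Theory.
Local Open Scope ring_scope.

Definition vec3 (F : finFieldType) := {ffun 'I_3 -> F}.

Definition proj_class (F : finFieldType) (v : vec3 F) : {set vec3 F} :=
  [set [ffun i => c * v i] | c : F & c != 0].

Definition plane_curve (F : finFieldType) (d : nat) (f : {mpoly F[3]}) : Prop :=
  f != 0 /\ f \is d.-homog.

Definition rat_points (F : finFieldType) (f : {mpoly F[3]}) : {set {set vec3 F}} :=
  [set proj_class v | v : vec3 F & (v != 0) && (f.@[v] == 0)].

Definition npoints (F : finFieldType) (f : {mpoly F[3]}) : nat := #|rat_points f|.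

Definition is_N3 (F : finFieldType) (d N : nat) : Prop :=
  (exists f : {mpoly F[3]}, plane_curve d f /\ (npoints f < d * #|F| - d + 3)%N /\ npoints f = N) /\
  (forall f : {mpoly F[3]}, plane_curve d f -> (npoints f < d * #|F| - d + 3)%N -> (npoints f <= N)%N).

(* Main.v *)
From Stdlib Require Import Classical.
Require Import Defs.
From HB Require Import structures.
From mathcomp Require Import all_boot all_order all_algebra all_field.
From mathcomp Require Import mpoly.
From mathcomp Require Import fingroup pgroup abelian ring zify.
Set Implicit Arguments. Unset Strict Implicit. Unset Printing Implicit Defensive.
Import GRing.Theory.
Local Open Scope ring_scope.

(* Split off the rational lines of the curve: f = g * (k lines), with g of degree e free of rational
   lines.  If 1 <= k < d, Sziklai's bound (e - 1) q + 1 for g and k q + 1 for the lines add up to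
   (d - 1) q + 2.  If k = d the curve is a line arrangement, treated by its maximal number of
   concurrent lines.

   Sziklai's bound for an irreducible g of degree e < q without rational singular point: let H_k be
   the coefficient of t^k in g (x + t x^q) and k >= 1 the least index such that g does not divide
   H_k.  At a rational point P the quotients H_i / g, i < k, can be computed on any line through P;
   comparing a tangent of contact order j with a transversal gives (1 + t)^(j - 1) = 1 mod t^k, so
   that j > k.  Hence g and H_k both vanish to order k + 1 along the tangent at each of the N
   rational points, and Bezout gives (k + 1) N <= e (e + k (q - 1)).  For k = 1 this is the argument
   of Stohr and Voloch; larger k covers the Frobenius nonclassical curves.

   Degree q without lines: sum g l_1 ... l_(q - 2) over the affine space for linear forms l_i.  As
   the degree is less than 3 (q - 1) the sum is 0, so q - 2 lines cannot cover all but one of the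
   rational points outside the curve; when there are at most 2 q - 2 of these, pairing them
   produces such lines. *)

(** * Unique factorisation in polynomial rings *)

(** Forms are cut into irreducible factors, while Bezout's inequality needs a prime form in order to
    know every syzygy [a f + b h = 0]; unique factorisation in [{mpoly F[3]}] bridges the two. No
    intersection multiplicity is defined: contact is measured along one rational line at each point,
    which is all that a dimension count needs. The Frobenius pencil is tractable because Frobenius
    fixes rational points and directions, so a pencil based on a rational line stays on that line
    and has an explicit expansion there. The estimate for irreducible forms has slack proportional
    to [q - 1 - e], which is negative at [e = q]; in that degree the bound is recast as the
    existence of at least [2 q - 1] rational points off the curve. The two regimes of the theorem
    compare [d q + 1 - 2 (d - 3)], coming from arrangements, with [(d - 1) q + 2], coming from all
    other curves: the difference is [q + 5 - 2 d]. *)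

Section Factorial.
Variable R : idomainType.
Implicit Types a b c p x y : R.

Definition divides a b := exists c, b = c * a.

Definition prime_elt p :=
  [/\ p != 0, ~ divides p 1 & forall a b, divides p (a * b) -> divides p a \/ divides p b].

Definition irred_elt p :=
  [/\ p != 0, ~ divides p 1 & forall a b, p = a * b -> divides a 1 \/ divides b 1].

(** Unique factorisation in a form suited to induction: an additive measure vanishing only on units
    bounds the number of factors, and primality of irreducibles gives uniqueness. *)
Definition factorial_measure (delta : R -> nat) :=
  [/\ forall a b, a != 0 -> b != 0 -> delta (a * b) = (delta a + delta b)%N,
      forall a, a != 0 -> delta a = 0%N -> divides a 1
    & forall p, irred_elt p -> prime_elt p].

Lemma divides_mulr a b c : divides a b -> divides a (c * b).
Proof. by case=> d ->; exists (c * d); rewrite mulrA. Qed.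

Lemma divides_add a b c : divides a b -> divides a c -> divides a (b + c).
Proof. by case=> d -> [e ->]; exists (d + e); rewrite mulrDl. Qed.

Lemma divides_sum (I : Type) (r : seq I) (P : pred I) (G : I -> R) a :
  (forall i, P i -> divides a (G i)) -> divides a (\sum_(i <- r | P i) G i).
Proof.
move=> h; apply: (big_ind (divides a)) => //; first by exists 0; rewrite mul0r.
exact: divides_add.
Qed.

Lemma nonunit_measure delta a : factorial_measure delta -> a != 0 -> ~ divides a 1 -> (0 < delta a)%N.
Proof. by move=> [_ h _] a0 nu; rewrite lt0n; apply/eqP => /(h _ a0). Qed.

(** Existence of prime factorisations as an induction principle; nonunits have positive measure, so
    both factors of a proper splitting have smaller measure. *)
Lemma factorial_measure_ind delta (P : R -> Prop) : factorial_measure delta ->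
  (forall a, divides a 1 -> P a) -> (forall p, prime_elt p -> P p) ->
  (forall a b, a != 0 -> b != 0 -> P a -> P b -> P (a * b)) ->
  forall a, a != 0 -> P a.
Proof.
move=> fd Pu Pp Pm a; have [n] := ubnP (delta a); elim: n a => // n IH a.
rewrite ltnS => le_an a0; case: (classic (divides a 1)) => [/Pu//|nu].
case: (fd) => hM h0 hp; case: (classic (irred_elt a)) => [/hp/Pp//|nirr].
case: (classic (exists x y, [/\ a = x * y, ~ divides x 1 & ~ divides y 1])); last first.
  move=> h; case: nirr; split=> // x y axy; apply: NNPP => /not_or_and[nx ny].
  by apply: h; exists x, y.
case=> x [y [axy nx ny]]; move: a0 le_an; rewrite axy mulf_eq0 negb_or => /andP[x0 y0].
have dx := nonunit_measure fd x0 nx; have dy := nonunit_measure fd y0 ny.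
rewrite hM // => le; apply: Pm => //; apply: IH => //; apply: leq_trans le.
  by rewrite -ltn_subLR ?subnn.
by rewrite addnC -ltn_subLR ?subnn.
Qed.

End Factorial.

(** * Gauss's lemma and unique factorisation in one variable *)

Section Gauss.
Variable R : idomainType.

Lemma dividesCP (p : R) (f : {poly R}) : divides p%:P f <-> forall i, divides p f`_i.
Proof.
split=> [[g ->] i|h]; first by exists g`_i; rewrite coefMC.
have [g hg] : exists g : nat -> R, forall i, (i < size f)%N -> f`_i = g i * p.
  elim: (size f) => [|n [g hg]]; first by exists (fun=> 0).
  have [c hc] := h n; exists (fun i => if i == n then c else g i) => i.
  by rewrite ltnS leq_eqVlt; case: eqP => [-> //|_ /= /hg].
exists (\poly_(i < size f) g i); apply/polyP => i; rewrite coefMC coef_poly.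
by case: ltnP => [/hg //|le]; rewrite mul0r nth_default.
Qed.

Lemma first_failure (P : nat -> Prop) : ~ (forall i, P i) ->
  exists i, ~ P i /\ forall j, (j < i)%N -> P j.
Proof.
move=> h; apply: NNPP => h'; apply: h => i; elim/ltn_ind: i => i IH.
by apply: NNPP => nP; apply: h'; exists i.
Qed.

(** Gauss's lemma: take the first coefficients of [a] and [b] not divisible by [p], at [i] and [j].
    In the coefficient of [a * b] at [i + j] every other term is divisible by [p], hence so is the
    product of these two. *)
Lemma prime_polyC (p : R) : prime_elt p -> prime_elt p%:P.
Proof.
move=> [p0 pu pp]; split; first by rewrite polyC_eq0.
  by move/dividesCP/(_ 0%N); rewrite coef1.
move=> a b /dividesCP pab; rewrite !dividesCP; apply: NNPP => /not_or_and[].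
move=> /first_failure[i [ni hi]] /first_failure[j [nj hj]].
have := pab (i + j)%N; rewrite coefM (bigD1 (inord i)) //= inordK ?ltnS ?leq_addr // addKn.
set S := \sum_(_ < _ | _) _ => h.
suff [d hd] : divides p S.
  have : divides p (a`_i * b`_j).
    by case: h => c hc; exists (c - d); rewrite mulrBl -hc hd addrK.
  by case/pp.
apply: divides_sum => k; rewrite -val_eqE /= inordK ?ltnS ?leq_addr // => ne.
have [lt|gt|e] := ltngtP k i; last by rewrite e eqxx in ne.
  by rewrite mulrC; apply/divides_mulr/hi.
by apply/divides_mulr/hj; rewrite ltn_subLR ?ltn_add2r // -ltnS.
Qed.

(* Factorisations over the fraction field, written with a denominator [c], descend to [R]. *)
Lemma gauss_cancel (delta : R -> nat) (c : R) (f g k : {poly R}) : factorial_measure delta -> c != 0 ->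
  c *: f = g * k -> exists a b g' k', [/\ a != 0, b != 0, g = a *: g', k = b *: k' & f = g' * k'].
Proof.
move=> fd c0; move: c c0 f g k; apply: (factorial_measure_ind fd) => [c|p|a b a0 b0 IHa IHb].
- case=> d dc1 f g k cf; have c0 : c != 0.
    by apply/eqP => c0; move: dc1 => /eqP; rewrite c0 mulr0 oner_eq0.
  exists c, 1, (d *: g), k; rewrite oner_eq0 scale1r scalerA mulrC -dc1 scale1r.
  by split=> //; rewrite -scalerAl -cf scalerA -dc1 scale1r.
- move=> pp f g k cf; have [p0 _ _] := pp; have [_ _ hp] := prime_polyC pp.
  have pgk : divides p%:P (g * k) by exists f; rewrite -cf mulrC mul_polyC.
  have cancel (u v : {poly R}) : p *: u = p *: v -> u = v.
    by rewrite -!mul_polyC; apply: mulfI; rewrite polyC_eq0.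
  case: (hp _ _ pgk) => -[h hE].
    exists p, 1, h, k; rewrite oner_eq0 scale1r -mul_polyC mulrC; split=> //.
    by apply: cancel; rewrite cf hE mulrC -mul_polyC; ring.
  exists 1, p, g, h; rewrite oner_eq0 scale1r -mul_polyC mulrC; split=> //.
  by apply: cancel; rewrite cf hE -mul_polyC; ring.
- move=> f g k abf; rewrite -scalerA in abf.
  have [x [y [g1 [k1 [x0 y0 -> -> e]]]]] := IHa _ _ _ abf.
  have [x' [y' [g2 [k2 [x0' y0' -> -> ->]]]]] := IHb _ _ _ e.
  by exists (x * x'), (y * y'), g2, k2; rewrite !mulf_neq0 // !scalerA.
Qed.

Lemma divides_polyC1 (f : {poly R}) : divides f 1 -> size f = 1%N.
Proof.
case=> g /esym/(congr1 (fun p : {poly R} => size p)); have [->|f0] := eqVneq f 0.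
  by rewrite mulr0 size_poly0 size_poly1.
have [->|g0] := eqVneq g 0; first by rewrite mul0r size_poly0 size_poly1.
rewrite size_mul // size_poly1; move: f0 g0; rewrite -!size_poly_gt0.
by case: (size f) => [//|[//|n]]; case: (size g) => [//|m]; rewrite addSn !addnS.
Qed.

(** Divisibility over the fraction field descends to [R]: once [c] is cancelled, [f] is a constant
    times a factor [f'] of the same degree, and irreducibility makes that constant a unit. *)
Lemma irred_divides_scale (delta : R -> nat) (c : R) (f a q : {poly R}) : factorial_measure delta ->
  (1 < size f)%N -> irred_elt f -> c != 0 -> c *: a = q * f -> divides f a.
Proof.
move=> fd f1 [f0 _ fi] c0 /(gauss_cancel fd c0)[x [y [q' [f' [x0 y0 _ ef ->]]]]].
have [[z hz]|/divides_polyC1 f'1] := fi y%:P f' ltac:(by rewrite mul_polyC).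
  by exists (q' * z); rewrite ef -mul_polyC -mulrA (mulrA z) -hz mul1r.
by rewrite ef size_scale // f'1 in f1.
Qed.

(** Either the pseudo-gcd of [f] and [a] has the size of [f], and [f] divides [a] up to a constant,
    or it is constant by irreducibility, and a Bezout relation multiplied by [b] shows that [f]
    divides a constant multiple of [b]. *)
Lemma poly_irred_prime (delta : R -> nat) (f : {poly R}) : factorial_measure delta ->
  (1 < size f)%N -> irred_elt f -> prime_elt f.
Proof.
move=> fd f1 fI; have [f0 fu fi] := fI; split=> // a b [c abc].
have ext := irred_divides_scale fd f1 fI.
have [e|ne] := eqVneq (size (gcdp f a)) (size f).
  left; have : f %| a.
    have := dvdp_size_eqp (dvdp_gcdl f a); rewrite e eqxx => /esym/eqp_dvdl <-.
    exact: dvdp_gcdr.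
  by case/Pdiv.Idomain.dvdpP => -[x y] /= x0 /ext; apply.
have /Pdiv.Idomain.dvdpP[[x y] /= x0] := dvdp_gcdl f a.
case/(gauss_cancel fd x0) => [u [v [q [g [u0 v0 _ eg ef]]]]].
have [q0 g0] : q != 0 /\ g != 0 by apply/andP; rewrite -negb_or -mulf_eq0 -ef.
case: (fi _ _ ef) => /divides_polyC1 s1.
  by rewrite eg ef size_scale // size_mul // s1 eqxx in ne.
have : coprimep f a by rewrite coprimep_def eg size_scale // s1.
case/Bezout_coprimepP => -[z w] /= /eqpP[[c1 c2] /= /andP[c10 c20] ez].
right; apply: (ext c2 b (c1 *: (z * b + w * c)) c20).
transitivity (b * (c2 *: 1)); first by rewrite -scalerAr mulr1.
by rewrite -ez -!scalerAr -!scalerAl; congr (_ *: _); rewrite mulrDr mulrDl -!mulrA -abc; ring.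
Qed.

Lemma polyC_irred (c : R) : irred_elt c%:P -> irred_elt c.
Proof.
have dP (a : R) : divides a%:P 1 -> divides a 1.
  by move/dividesCP/(_ 0%N); rewrite coef1.
move=> [c0 cu ci]; split; first by rewrite -polyC_eq0.
  by case=> d cd; apply: cu; exists d%:P; rewrite -polyCM -cd.
by move=> a b cab; have [/dP|/dP] := ci a%:P b%:P ltac:(by rewrite cab polyCM); [left|right].
Qed.

Lemma poly_factorial (delta : R -> nat) : factorial_measure delta ->
  factorial_measure (fun f : {poly R} => (size f).-1 + delta (lead_coef f))%N.
Proof.
move=> fd; have [hM h0 hp] := fd; split.
- move=> a b a0 b0; rewrite lead_coefM hM ?lead_coef_eq0 // size_mul //.
  move: a0 b0; rewrite -!size_poly_gt0; case: (size a) => // m _; case: (size b) => // n _.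
  by rewrite addnS /= addnACA.
- move=> a a0 /eqP; rewrite addn_eq0 => /andP[/eqP s1 /eqP].
  have /size_poly1P[c c0 ->] : size a == 1%N by move: a0 s1; rewrite -size_poly_gt0; case: (size a) => [|[]].
  by rewrite lead_coefC => /(h0 _ c0)[d cd]; exists d%:P; rewrite -polyCM -cd.
move=> p pI; have [p1|/(poly_irred_prime fd)] := leqP (size p) 1; last exact.
have [p0 _ _] := pI; have /size_poly1P[c c0 pc] : size p == 1%N by rewrite eqn_leq p1 size_poly_gt0.
by move: pI; rewrite pc => /polyC_irred/hp/prime_polyC.
Qed.

End Gauss.

Section Transfer.
Variables (R S : idomainType) (f : {rmorphism R -> S}) (g : {rmorphism S -> R}).
Hypotheses (fK : cancel f g) (gK : cancel g f).

Lemma divides_iso a b : divides (f a) (f b) <-> divides a b.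
Proof.
split=> [[c h]|[c ->]]; last by exists (f c); rewrite rmorphM.
by exists (g c); rewrite -[LHS]fK h rmorphM fK.
Qed.

Lemma prime_iso a : prime_elt (f a) -> prime_elt a.
Proof.
case=> a0 au ap; split; first by apply: contraNneq a0 => ->; rewrite rmorph0.
  by move=> h; apply: au; rewrite -(rmorph1 f) divides_iso.
by move=> x y; rewrite -!divides_iso rmorphM => /ap.
Qed.

Lemma irred_iso a : irred_elt a -> irred_elt (f a).
Proof.
case=> a0 au ai; split; first by apply: contraNneq a0 => h; rewrite -[a]fK h rmorph0.
  by rewrite -(rmorph1 f) divides_iso.
move=> x y h; have [] := ai (g x) (g y) ltac:(by rewrite -rmorphM -h fK).
  by rewrite -divides_iso gK rmorph1; left.
by rewrite -divides_iso gK rmorph1; right.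
Qed.

Lemma factorial_iso (delta : S -> nat) :
  factorial_measure delta -> factorial_measure (fun a => delta (f a)).
Proof.
have f0 a : a != 0 -> f a != 0 by apply: contraNneq => h; rewrite -[a]fK h rmorph0.
case=> hM h0 hp; split.
- by move=> a b a0 b0; rewrite rmorphM hM ?f0.
- by move=> a a0 /(h0 _ (f0 _ a0)); rewrite -(rmorph1 f) divides_iso.
by move=> p /irred_iso/hp/prime_iso.
Qed.

End Transfer.

(** * Unique factorisation in several variables, and factors of homogeneous polynomials *)

Section MpolyFactorial.
Variable F : fieldType.

Lemma mmap_unique n (S : comNzRingType) (u : {rmorphism {mpoly F[n]} -> S}) p :
  u p = mmap (u \o @mpolyC n F) (fun i => u 'X_i) p.
Proof.
rewrite {1}[p]mpolyE rmorph_sum /mmap; apply: eq_bigr => m _.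
rewrite -mul_mpolyC rmorphM /=; congr (_ * _).
by rewrite mpolyXE_id rmorph_prod; apply: eq_bigr => i _; rewrite rmorphXn.
Qed.

Lemma mpoly_rmorph_eq n (S : comNzRingType) (u v : {rmorphism {mpoly F[n]} -> S}) :
  (forall c, u c%:MP = v c%:MP) -> (forall i, u 'X_i = v 'X_i) -> u =1 v.
Proof.
move=> hC hX p; rewrite (mmap_unique u) (mmap_unique v) /mmap; apply: eq_bigr => m _ /=.
by rewrite hC; congr (_ * _); apply: eq_bigr => i _; rewrite hX.
Qed.

Lemma muniX n i : muni ('X_i : {mpoly F[n.+1]}) = if unlift ord_max i is Some j then ('X_j)%:P else 'X.
Proof.
rewrite muniE msuppX big_seq1 mcoeffX eqxx scale1r.
case: unliftP => [j|] ->; rewrite mnm1E.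
  rewrite eq_sym (negPf (neq_lift _ _)) expr0 alg_polyC; congr ((mpolyX _ _)%:P).
  by apply/mnmP => k; rewrite mnmE !mnm1E -!val_eqE /= /bump leqNgt ltn_ord.
rewrite eqxx expr1 (_ : [multinom _ | _ < _] = 0%MM) ?mpolyX0 ?scale1r //.
by apply/mnmP => k; rewrite mnmE mnm1E mnm0E -val_eqE /= gtn_eqF.
Qed.

Lemma mwidenXU n j : mwiden ('X_j : {mpoly F[n]}) = 'X_(lift ord_max j).
Proof.
rewrite mwidenX mnmwiden1; congr (mpolyX _ U_(_)).
by apply/val_inj; rewrite /= /bump leqNgt ltn_ord.
Qed.

Definition multi_of_uni n : {poly {mpoly F[n]}} -> {mpoly F[n.+1]} :=
  horner_eval 'X_ord_max \o map_poly (@mwiden n F).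

HB.instance Definition _ n := GRing.RMorphism.on (@multi_of_uni n).

Lemma muniK n : cancel (@muni n F) (@multi_of_uni n).
Proof.
apply: (mpoly_rmorph_eq (u := @multi_of_uni n \o @muni n F) (v := idfun)) => [c|i] /=.
  by rewrite muniC /multi_of_uni /= map_polyC /= /horner_eval hornerC mwidenC.
rewrite muniX; case: unliftP => [j|] ->; rewrite /multi_of_uni /horner_eval /=.
  by rewrite map_polyC hornerC /= mwidenXU.
by rewrite map_polyX hornerX.
Qed.

Lemma mmulti_uniK n : cancel (@multi_of_uni n) (@muni n F).
Proof.
have muniw : @muni n F \o @mwiden n F =1 polyC.
  apply: mpoly_rmorph_eq => [c|i] /=; first by rewrite mwidenC muniC.
  by rewrite mwidenXU muniX liftK.
move=> p; rewrite /multi_of_uni /= /horner_eval -horner_map /= muniX unlift_none.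
by rewrite -map_poly_comp (eq_map_poly muniw) -[RHS]comp_polyXr.
Qed.

Lemma mpoly_factorial n : exists delta : {mpoly F[n]} -> nat, factorial_measure delta.
Proof.
elim: n => [|n [delta fd]]; last first.
  by eexists; apply: (factorial_iso (@muniK n) (@mmulti_uniK n)); apply: poly_factorial fd.
have unit0 (a : {mpoly F[0]}) : a != 0 -> divides a 1.
  have -> : a = (a@_0%MM)%:MP.
    by apply/mpolyP => m; rewrite mcoeffC (_ : m = 0%MM) ?eqxx ?mulr1 //; apply/mnmP; case.
  by rewrite mpolyC_eq0 => c0; exists ((a@_0%MM)^-1)%:MP; rewrite -mpolyCM mulVf.
exists (fun=> 0%N); split=> // [a a0 _|p [p0 pu _]]; first exact: unit0.
by case: pu; apply: unit0.
Qed.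

Lemma mpoly_irred_prime n (f : {mpoly F[n]}) : irred_elt f -> prime_elt f.
Proof. by have [delta [_ _]] := mpoly_factorial n; apply. Qed.

(** Over a domain the lowest terms multiply to the lowest term and the leading terms to the leading
    term. In a monomial both have degree [d], so the lowest and highest degrees agree in each
    factor. *)
Lemma poly_monomial_factor (A : idomainType) (p q : {poly A}) (c : A) d : c != 0 ->
  p * q = c *: 'X^d -> (d = (size p).-1 + (size q).-1)%N /\ forall k, p`_k != 0 -> k = (size p).-1.
Proof.
move=> c0 e; have e0 : c *: 'X^d != 0 :> {poly A} by rewrite -mul_polyC mulf_neq0 ?polyC_eq0 // -size_poly_gt0 size_polyXn.
have [p0 q0] : p != 0 /\ q != 0 by apply/andP; rewrite -negb_or -mulf_eq0 e.
have sd : (d = (size p).-1 + (size q).-1)%N.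
  have := congr1 (fun r : {poly A} => size r) e; rewrite size_mul // size_scale // size_polyXn => /(congr1 predn) /= <-.
  by move: p0 q0; rewrite -!size_poly_gt0; case: (size p) => // m _; case: (size q) => // n _; rewrite addnS.
have ex (r : {poly A}) : r != 0 -> exists k, r`_k != 0 by exists (size r).-1; rewrite -lead_coefE lead_coef_eq0.
split=> // k pk; case: (ex_minnP (ex _ p0)) => i pi mi; case: (ex_minnP (ex _ q0)) => j qj mj.
have low : (p * q)`_(i + j) = p`_i * q`_j.
  rewrite coefM (bigD1 (inord i)) //= inordK ?ltnS ?leq_addr // addKn big1 ?addr0 // => l.
  rewrite -val_eqE /= inordK ?ltnS ?leq_addr // => ne.
  have [lt|gt|E] := ltngtP l i; last by rewrite E eqxx in ne.
    by have [->|/mi] := eqVneq p`_l 0; rewrite ?mul0r // leqNgt lt.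
  have [->|/mj] := eqVneq q`_(i + j - l) 0; first by rewrite mulr0.
  by have := ltn_ord l; lia.
have ij : (i + j)%N = d.
  move: low; rewrite e coefZ coefXn; case: eqP => // _ /esym/eqP.
  by rewrite mulr0 mulf_eq0 (negPf pi) (negPf qj).
have lt (r : {poly A}) l : r`_l != 0 -> (l <= (size r).-1)%N.
  move=> h; have : (l < size r)%N by rewrite ltnNge; apply: contraNN h => le; rewrite nth_default.
  by case: (size r).
have := lt _ _ pk; have := lt _ _ qj; have := mi _ pk; move: ij; rewrite sd; lia.
Qed.

Lemma poly_monomial_factor2 (A : idomainType) (p q : {poly A}) (c : A) d : c != 0 ->
  p * q = c *: 'X^d -> exists d1 d2, [/\ d = (d1 + d2)%N,
    forall k, p`_k != 0 -> k = d1 & forall k, q`_k != 0 -> k = d2].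
Proof.
move=> c0 e; exists (size p).-1, (size q).-1; have [ed h1] := poly_monomial_factor c0 e.
by split=> //; rewrite mulrC in e; have [] := poly_monomial_factor c0 e.
Qed.

(** The substitution of [x_i T] for [x_i]: the coefficient of [T^k] is the homogeneous component of
    degree [k], so being homogeneous becomes being a monomial in [T]. *)
Definition grade n : {mpoly F[n]} -> {poly {mpoly F[n]}} :=
  mmap (polyC \o @mpolyC n F) (fun i => 'X_i *: 'X).

HB.instance Definition _ n := GRing.RMorphism.on (@grade n).

Lemma gradeX n m : grade 'X_[m] = 'X_[m] *: 'X^(mdeg m) :> {poly {mpoly F[n]}}.
Proof.
rewrite /grade mmapX /mmap1 mpolyXE_id mdegE.
elim/big_rec3: _ => [|i p k q _ ->]; first by rewrite scale1r.
by rewrite exprZn -scalerAl -scalerAr scalerA exprD.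
Qed.

Lemma coef_grade n k (p : {mpoly F[n]}) : (grade p)`_k = pihomog mdeg k p.
Proof.
rewrite pihomogE {1}[p]mpolyE rmorph_sum coef_sum [RHS]big_mkcond; apply: eq_bigr => m _ /=.
rewrite -mul_mpolyC rmorphM /= gradeX /grade mmapC /= coefCM coefZ coefXn eq_sym.
by case: eqP; rewrite ?mulr1 ?mulr0 ?mul_mpolyC.
Qed.

Lemma grade_homog n d (p : {mpoly F[n]}) : p \is d.-homog -> grade p = p *: 'X^d.
Proof.
move=> pd; apply/polyP => k; rewrite coef_grade coefZ coefXn.
case: eqVneq => [->|ne]; first by rewrite mulr1 pihomog_dE.
by rewrite mulr0 (pihomog_ne0 _ pd) // eq_sym.
Qed.

Lemma homog_factorl n (a b : {mpoly F[n]}) d : a * b != 0 -> a * b \is d.-homog ->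
  exists2 d1, (d1 <= d)%N & a \is d1.-homog /\ b \is (d - d1).-homog.
Proof.
have homP (x : {mpoly F[n]}) D : (forall k, (grade x)`_k != 0 -> k = D) -> x \is D.-homog.
  move=> h; rewrite (pihomog_partitionE (leqnn (msize x))) rpred_sum // => i _.
  have [->|] := eqVneq (pihomog mdeg i x) 0; first exact: rpred0.
  by rewrite -coef_grade => /h <-; rewrite coef_grade pihomogP.
move=> ab0 /grade_homog; rewrite rmorphM => /(poly_monomial_factor2 ab0)[d1 [d2 [-> h1 h2]]].
exists d1; first exact: leq_addr.
by split; [exact: (homP _ _ h1) | rewrite addKn; exact: (homP _ _ h2)].
Qed.

End MpolyFactorial.

(** * Restriction to lines and Frobenius polars *)

Section Evaluation.
Variables (F : fieldType) (n : nat).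
Implicit Types (f g : {mpoly F[n]}) (P v : 'I_n -> F).

Lemma rmorph_mmap (A B : comNzRingType) (iota : {rmorphism F -> A}) (theta : {rmorphism A -> B}) (h : 'I_n -> A) f :
  theta (mmap iota h f) = mmap (theta \o iota) (theta \o h) f.
Proof.
rewrite /mmap rmorph_sum; apply: eq_bigr => m _; rewrite rmorphM; congr (_ * _).
by rewrite /mmap1 rmorph_prod; apply: eq_bigr => i _; rewrite rmorphXn.
Qed.

Lemma eq_mmap (A : nzRingType) (iota iota' : F -> A) (h h' : 'I_n -> A) f :
  iota =1 iota' -> h =1 h' -> mmap iota h f = mmap iota' h' f.
Proof. by move=> ei eh; apply: eq_bigr => m _; rewrite ei (mmap1_eq _ eh). Qed.

Lemma homog_mdeg d f m : f \is d.-homog -> m \in msupp f -> mdeg m = d.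
Proof. by move=> /dhomogP fd /fd. Qed.

Lemma mmap_homog_scale (A : comNzRingType) (iota : {rmorphism F -> A}) (h : 'I_n -> A) d (c : A) f :
  f \is d.-homog -> mmap iota (fun i => c * h i) f = c ^+ d * mmap iota h f.
Proof.
move=> fd; rewrite /mmap mulr_sumr !big_seq; apply: eq_bigr => m /(homog_mdeg fd) <-.
rewrite mulrCA; congr (_ * _); rewrite /mmap1 mdegE -prodrXr -big_split /=.
by apply: eq_bigr => i _; rewrite exprMn.
Qed.

Definition on_line P v : {mpoly F[n]} -> {poly F} :=
  mmap polyC (fun i => (P i)%:P + v i *: 'X).

HB.instance Definition _ P v := GRing.RMorphism.on (on_line P v).

Lemma on_lineC P v c : on_line P v c%:MP = c%:P.
Proof. by rewrite /on_line mmapC. Qed.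

Lemma on_lineX P v i : on_line P v 'X_i = (P i)%:P + v i *: 'X.
Proof. by rewrite /on_line mmapX mmap1U. Qed.

Lemma horner_on_line P v t f : (on_line P v f).[t] = f.@[fun i => P i + v i * t].
Proof.
rewrite -/(horner_eval t _) /on_line rmorph_mmap; apply: eq_mmap => [c|i] /=.
  by rewrite /horner_eval hornerC.
by rewrite /horner_eval hornerD hornerC hornerZ hornerX.
Qed.

Lemma on_line_coef0 P v f : (on_line P v f)`_0 = f.@[P].
Proof. by rewrite -horner_coef0 horner_on_line; apply: meval_eq => i; rewrite mulr0 addr0. Qed.

Section Homogenisation.
Variables (A : comNzRingType) (iota : {rmorphism F -> A}) (al be : A).

(** The binary form of degree [d] that dehomogenises to [p], evaluated at [(al, be)]. The general
    target [A] lets one identity serve scalars, linear forms and pencils. *)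
Definition homogenise d (p : {poly F}) : A := \sum_(k < d.+1) iota p`_k * al ^+ (d - k) * be ^+ k.

Lemma homogenise_mul_linear d (p : {poly F}) u w : (size p <= d.+1)%N ->
  homogenise d.+1 (p * (u%:P + w *: 'X)) = homogenise d p * (al * iota u + be * iota w).
Proof.
move=> sp; rewrite [RHS]mulrDr /homogenise.
have -> : \sum_(k < d.+2) iota (p * (u%:P + w *: 'X))`_k * al ^+ (d.+1 - k) * be ^+ k =
  \sum_(k < d.+2) iota (p`_k * u) * al ^+ (d.+1 - k) * be ^+ k +
  \sum_(k < d.+2) iota (if (k == 0 :> nat)%N then 0 else p`_k.-1 * w) * al ^+ (d.+1 - k) * be ^+ k.
  rewrite -big_split; apply: eq_bigr => k _ /=; rewrite -!mulrDl -rmorphD mulrDr coefD coefMC.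
  by rewrite -scalerAr coefZ coefMX; case: eqP => _; rewrite ?mulr0 // [w * _]mulrC.
rewrite big_ord_recr /= nth_default // mul0r rmorph0 !mul0r addr0.
rewrite [X in _ + X]big_ord_recl /= rmorph0 !mul0r add0r !mulr_suml; congr (_ + _).
  apply: eq_bigr => k _; rewrite rmorphM /= subSn; last by rewrite -ltnS ltn_ord.
  by rewrite exprS; move: (al ^+ _) (be ^+ _) (iota _) (iota _) => x y z t; ring.
apply: eq_bigr => k _; rewrite rmorphM /= /bump /= add1n subSS exprS.
by move: (al ^+ _) (be ^+ _) (iota _) (iota _) => x y z t; ring.
Qed.

Lemma size_mul_linear (p : {poly F}) d u w : (size p <= d)%N -> (size (p * (u%:P + w *: 'X))%R <= d.+1)%N.
Proof.
move=> sp; apply: leq_trans (size_polyMleq _ _) _.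
have : (size (u%:P + w *: 'X : {poly F})%R <= 2)%N.
  by rewrite (leq_trans (size_polyD _ _)) // geq_max (leq_trans (size_polyC_leq1 _)) //
     (leq_trans (size_scale_leq _ _)) // size_polyX.
by move: sp; lia.
Qed.

Lemma mmap_on_line P v d f : f \is d.-homog ->
  mmap iota (fun i => al * iota (P i) + be * iota (v i)) f = homogenise d (on_line P v f).
Proof.
set h := fun i => _ + _ => fd.
have mono (s : seq 'I_n) (m : 'I_n -> nat) : let p := \prod_(i <- s) ((P i)%:P + v i *: 'X) ^+ m i in
   let D := (\sum_(i <- s) m i)%N in
   (size p <= D.+1)%N /\ \prod_(i <- s) h i ^+ m i = homogenise D p.
  elim: s => [|i s]; first rewrite !big_nil /homogenise big_ord1 size_poly1 coef1 rmorph1 !expr0 !mulr1 //.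
  rewrite !big_cons /=; move: (\prod_(_ <- _) _) (\sum_(_ <- _) _)%N (\prod_(_ <- _) _) => p D a [sp ->].
  elim: (m i) => [|k [sk ek]]; first by rewrite !expr0 !mul1r.
  rewrite !exprS -!mulrA ek addSn ![((P i)%:P + _) * _]mulrC; split; first exact: size_mul_linear.
  by rewrite homogenise_mul_linear // mulrC.
have hsum (I : Type) (s : seq I) (c : I -> F) (p : I -> {poly F}) :
   homogenise d (\sum_(i <- s) (c i)%:P * p i) = \sum_(i <- s) iota (c i) * homogenise d (p i).
  elim: s => [|i s IH]; first by rewrite !big_nil /homogenise big1 // => k _; rewrite coef0 rmorph0 !mul0r.
  rewrite !big_cons -IH /homogenise mulr_sumr -big_split; apply: eq_bigr => k _ /=.
  by rewrite coefD coefCM rmorphD rmorphM /=; ring.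
rewrite /on_line {2}/mmap hsum /mmap !big_seq; apply: eq_bigr => m /(homog_mdeg fd) md.
by congr (_ * _); rewrite -md mdegE; have [_] := mono (index_enum 'I_n) m.
Qed.

End Homogenisation.

End Evaluation.

Lemma coef_1addX (R : nzRingType) m k : ((1 + 'X) ^+ m : {poly R})`_k = 'C(m, k)%:R.
Proof.
rewrite addrC exprD1n coef_sum; under eq_bigr => i _ do rewrite coefMn coefXn.
have [km|mk] := leqP k m; last first.
  rewrite bin_small // big1 // => i _; case: eqP => [ki|_]; last by rewrite mul0rn.
  by have := ltn_ord i; rewrite -ki ltnS leqNgt mk.
rewrite (bigD1 (Ordinal (km : (k < m.+1)%N))) //= eqxx big1 ?addr0 // => i.
by rewrite -val_eqE /= eq_sym => /negPf ->; rewrite mul0rn.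
Qed.

Section Polar.
Variables (F : finFieldType) (n : nat).
Implicit Types (f g : {mpoly F[n]}) (P v : 'I_n -> F).
Local Notation q := #|F|.

Lemma frobenius_linear (a b : F) : (a%:P + b *: 'X) ^+ q = a%:P + b *: 'X^q :> {poly F}.
Proof.
have [p pp pF] := finPcharP F.
have pq : p.-nat q by have := abelem_pgroup (fin_ring_pchar_abelem pF); rewrite /pgroup cardsT.
have pP : p \in [pchar {poly F}] by rewrite (rmorph_pchar (@polyC F)).
rewrite exprDn_pchar; last by rewrite (eq_pnat _ (pcharf_eq pP)).
by rewrite -polyC_exp expf_card exprZn expf_card.
Qed.

(* [\sum_k polar k f * 'X^k] is [f (x + 'X * x ^ q)], the pencil spanned by a point and its
   Frobenius image. *)
Definition frobenius_pencil : {mpoly F[n]} -> {poly {mpoly F[n]}} :=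
  mmap (polyC \o @mpolyC n F) (fun i => ('X_i)%:P + ('X_i ^+ q) *: 'X).

HB.instance Definition _ := GRing.RMorphism.on frobenius_pencil.

Definition polar k f : {mpoly F[n]} := (frobenius_pencil f)`_k.

Lemma polar_homog k d f : f \is d.-homog -> polar k f \is (d + k * q.-1).-homog.
Proof.
move=> fd; pose G d (p : {poly {mpoly F[n]}}) := forall k, p`_k \is (d + k * q.-1).-homog.
have GM d1 d2 p1 p2 : G d1 p1 -> G d2 p2 -> G (d1 + d2)%N (p1 * p2).
  move=> h1 h2 j; rewrite coefM rpred_sum // => i _.
  have -> : (d1 + d2 + j * q.-1 = d1 + i * q.-1 + (d2 + (j - i) * q.-1))%N.
    by have : (i <= j)%N := ltn_ord i; move=> /subnKC {1}<-; rewrite mulnDl; lia.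
  exact: dhomogM.
have G1 : G 0%N 1 by move=> j; rewrite coef1; case: j => [|j]; rewrite ?dhomog1 ?dhomog0.
have GX i : G 1%N (('X_i)%:P + ('X_i ^+ q) *: 'X).
  move=> j; have Xi : ('X_i : {mpoly F[n]}) \is 1.-homog by rewrite dhomogX /= mdeg1.
  rewrite coefD coefC coefZ coefX; case: j => [|[|j]] /=.
  - by rewrite mulr0 addr0.
  - rewrite mulr1 add0r mul1n add1n prednK ?(ltn_trans _ (finNzRing_gt1 F)) //.
    by rewrite -[X in X.-homog]mul1n; apply: dhomogMn.
  by rewrite mulr0 addr0 dhomog0.
rewrite /polar /frobenius_pencil /mmap coef_sum big_seq rpred_sum // => m /(homog_mdeg fd) md.
rewrite /= coefCM mul_mpolyC; apply: rpredZ.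
move: k; rewrite -/(G d _).
rewrite -md mdegE /mmap1; elim/big_rec2: _ => // i p e _ Gp; apply: (GM) => //.
by elim: (m i) => [|l IH]; rewrite ?expr0 // exprS -add1n; apply: (GM).
Qed.

Lemma polar0 f : polar 0 f = f.
Proof.
rewrite /polar -horner_coef0 -/(horner_eval 0 _) /frobenius_pencil rmorph_mmap.
rewrite [RHS](mmap_unique idfun); apply: eq_mmap => [c|i] /=.
  by rewrite /horner_eval hornerC.
by rewrite /horner_eval hornerD hornerC hornerZ hornerX mulr0 addr0.
Qed.

(** With [x] the parameter of the line and [t] that of the pencil, [(P + x v) + t (P + x^q v) = (1 +
    t) P + x (1 + t x^(q - 1)) v]. Substituted into the binary form of [f] on the line, this shows
    that the term of order [x^j] is the coefficient of [f] at [j] times [(1 + t)^(d - j)]. *)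
Lemma polar_low_order P v d j k f : f \is d.-homog -> (j <= d)%N ->
  (forall i, (i < j)%N -> (on_line P v f)`_i = 0) ->
  exists2 r, on_line P v (polar k f) = 'X^j * r & r`_0 = (on_line P v f)`_j *+ 'C(d - j, k).
Proof.
move=> fd jd low; set c := on_line P v f.
pose T : {poly {poly F}} := 'X%:P; pose W : {poly {poly F}} := 1 + ('X^(q.-1))%:P * 'X.
pose E := \sum_(i < d.+1 | (j <= i)%N) (c`_i)%:P%:P * (1 + 'X) ^+ (d - i) * (T ^+ (i - j) * W ^+ i).
have q0 : (0 < q)%N by rewrite (ltn_trans _ (finNzRing_gt1 F)).
have pencil : map_poly (on_line P v) (frobenius_pencil f) = T ^+ j * E.
  rewrite /frobenius_pencil rmorph_mmap.
  rewrite (@eq_mmap _ _ _ _ (polyC \o polyC) _ (fun i => (1 + 'X) * (polyC \o polyC) (P i) + (T * W) * (polyC \o polyC) (v i))).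
  - rewrite (mmap_on_line _ _ _ _ _ fd) /homogenise mulr_sumr [RHS]big_mkcond; apply: eq_bigr => i _ /=.
    case: leqP => [ji|/low ->]; last by rewrite !mul0r.
    rewrite exprMn -(subnKC ji) exprD subnKC //=.
    by move: _%:P%:P (_ ^+ (d - i)) (T ^+ j) (T ^+ _) (W ^+ i) => x1 x2 x3 x4 x5; ring.
  - by move=> a /=; rewrite map_polyC /= on_lineC.
  move=> i /=; rewrite rmorphD /= map_polyC /= map_polyZ map_polyX /= rmorphXn /= on_lineX frobenius_linear.
  rewrite /T /W -!mul_polyC !polyCD !polyCM -{1}(prednK q0) exprS polyCM; ring.
exists E`_k.
  by rewrite /polar -coef_map pencil /T -polyC_exp coefCM.
rewrite -horner_coef0 -/(horner_eval 0 _) -coef_map /E rmorph_sum /= (bigD1 (Ordinal (jd : (j < d.+1)%N))) //=.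
set ev := map_poly _.
have evC p : ev p%:P = p.[0]%:P by rewrite /ev map_polyC.
have evX : ev 'X = 'X by rewrite /ev map_polyX.
have evT : ev T = 0 by rewrite evC hornerX.
have evW : ev W = 1.
  rewrite /W /ev rmorphD rmorph1 rmorphM /= -/ev evC hornerXn expr0n.
  have := finNzRing_gt1 F; rewrite -subn1 -subn_gt0; case: (q - 1)%N => // l _.
  by rewrite mul0r addr0.
rewrite big1 ?addr0 => [|i /andP[ji ne]]; last first.
  rewrite /ev !rmorphM !rmorphXn /= -/ev evT expr0n subn_eq0 leqNgt ltn_neqAle ji.
  by rewrite -val_eqE /= eq_sym in ne; rewrite ne /= mul0r mulr0.
rewrite subnn expr0 mul1r /ev !rmorphM !rmorphXn rmorphD rmorph1 /= -/ev evC evX evW expr1n mulr1 hornerC.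
by rewrite coefCM coef_1addX mulr_natr.
Qed.

Lemma polar_quotient P v j d k f g : f \is d.-homog -> (j <= d)%N ->
  (forall i, (i < j)%N -> (on_line P v f)`_i = 0) -> (on_line P v f)`_j != 0 ->
  polar k f = f * g -> g.@[P] = 'C(d - j, k)%:R.
Proof.
move=> fd jd low cj E; have [r Er r0] := polar_low_order k fd jd low.
have [s Es s0] := polar_low_order 0 fd jd low.
rewrite polar0 in Es; rewrite bin0 mulr1n in s0.
move: Er; rewrite E rmorphM /= Es -mulrA => /(mulfI (monic_neq0 (monicXn _ _))) /(congr1 (fun p : {poly F} => p`_0)).
by rewrite coef0M s0 on_line_coef0 r0 -(mulr_natr (on_line P v f)`_j) => /(mulfI cj).
Qed.

(* A transversal line and a tangent line both compute the quotients [polar i f / f] at [P], so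
   [(1 + X) ^ (d - 1)] and [(1 + X) ^ (d - j)] agree to order [k]. *)
Lemma tangent_order P v u j d k f : f \is d.-homog -> (j <= d)%N -> f.@[P] = 0 ->
  (on_line P u f)`_1 != 0 -> (1 < j)%N ->
  (forall i, (i < j)%N -> (on_line P v f)`_i = 0) -> (on_line P v f)`_j != 0 ->
  (forall i, (0 < i < k)%N -> divides f (polar i f)) -> (k < j)%N.
Proof.
move=> fd jd fP cu j1 low cj hdiv; rewrite ltnNge; apply/negP => jk.
have low1 i : (i < 1)%N -> (on_line P u f)`_i = 0.
  by rewrite ltnS leqn0 => /eqP ->; rewrite on_line_coef0.
have d1 : (1 <= d)%N by apply: leq_trans (ltnW j1) jd.
have eqC i : (i < k)%N -> 'C(d - j, i)%:R = 'C(d - 1, i)%:R :> F.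
  case: (posnP i) => [->|i0 ik]; first by rewrite !bin0.
  have [|g] := hdiv i; first by rewrite i0.
  rewrite mulrC => E.
  by rewrite -(polar_quotient fd jd low cj E) -(polar_quotient fd d1 low1 cu E).
(* This product is [(1 + X)^(d - 1) - (1 + X)^(d - j)], whose coefficients below [k] vanish. *)
have : 'X^k %| (1 + 'X) ^+ (d - j) * ((1 + 'X) ^+ (j - 1) - 1 : {poly F}).
  rewrite mulrBr mulr1 -exprD addnBA ?(ltnW j1) // subnK //.
  apply/dvdpP; exists (drop_poly k ((1 + 'X) ^+ (d - 1) - (1 + 'X) ^+ (d - j))).
  rewrite -{1}[_ - _](poly_take_drop k) (_ : take_poly _ _ = 0) ?add0r //.
  apply/polyP => i; rewrite coef_take_poly coef0; case: ltnP => // ik.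
  by rewrite coefB !coef_1addX eqC // subrr.
rewrite Gauss_dvdpr; last first.
  apply: coprimep_expl; apply: coprimep_expr; rewrite coprimep_sym coprimepX.
  by rewrite rootE hornerD hornerX addr0 hornerC oner_eq0.
(* The top binomial coefficient is 1 in every characteristic, so [p] is nonzero of degree [j - 1],
   too small for a multiple of [X^k] when [j <= k]. *)
set p := _ - 1; have pj : p`_(j - 1) != 0.
  by rewrite coefB coef_1addX binn coef1 subn_eq0 leqNgt j1 subr0 oner_eq0.
have p0 : p != 0 by apply: contraNneq pj => ->; rewrite coef0.
move=> /(dvdp_leq p0); rewrite size_polyXn => kp; have := leq_trans kp (size_polyD _ _).
rewrite size_polyN size_poly1 -[1 in X in (_ <= maxn X _)%N]opprK -polyCN addrC size_exp_XsubC.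
by move: jk j1; lia.
Qed.

End Polar.

(** * Vectors, linear forms and tangent directions *)

Section Vectors.
Variable F : finFieldType.
Implicit Types (a b c u v w P : vec3 F) (x y : F) (f g : {mpoly F[3]}).

Definition i0 : 'I_3 := Ordinal (isT : 0 < 3)%N.
Definition i1 : 'I_3 := Ordinal (isT : 1 < 3)%N.
Definition i2 : 'I_3 := Ordinal (isT : 2 < 3)%N.

Lemma sum3 (V : nmodType) (G : 'I_3 -> V) : \sum_i G i = G i0 + G i1 + G i2.
Proof.
rewrite !big_ord_recl big_ord0 addr0 addrA.
by congr (G _ + G _ + G _); apply: val_inj.
Qed.

Lemma forall3 (Q : 'I_3 -> Prop) : Q i0 -> Q i1 -> Q i2 -> forall i, Q i.
Proof.
move=> h0 h1 h2 [[|[|[|//]]] lt].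
- by rewrite (_ : Ordinal lt = i0) //; apply: val_inj.
- by rewrite (_ : Ordinal lt = i1) //; apply: val_inj.
by rewrite (_ : Ordinal lt = i2) //; apply: val_inj.
Qed.

Definition dot a v : F := \sum_i a i * v i.

(** The cross product gives both the line joining two points and the meeting point of two lines; it
    vanishes exactly on proportional vectors. *)
Definition cross a b : vec3 F := [ffun i : 'I_3 =>
  [:: a i1 * b i2 - a i2 * b i1; a i2 * b i0 - a i0 * b i2; a i0 * b i1 - a i1 * b i0]`_i].

Lemma crossE a b : (cross a b i0 = a i1 * b i2 - a i2 * b i1) *
  (cross a b i1 = a i2 * b i0 - a i0 * b i2) * (cross a b i2 = a i0 * b i1 - a i1 * b i0).
Proof. by rewrite !ffunE. Qed.

Definition scale x v : vec3 F := [ffun i => x * v i].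

Lemma vec3P v w : v i0 = w i0 -> v i1 = w i1 -> v i2 = w i2 -> v = w.
Proof. by move=> *; apply/ffunP; apply: forall3. Qed.

Lemma vec3_neq0 v : v != 0 -> exists i, v i != 0.
Proof.
move=> v0; apply/existsP; apply: contraNT v0; rewrite negb_exists => /forallP h.
by apply/eqP/ffunP => i; rewrite ffunE; apply/eqP; rewrite -[_ == _]negbK.
Qed.

Lemma scale_eq0 x v : (scale x v == 0) = (x == 0) || (v == 0).
Proof.
apply/eqP/orP => [h|[]/eqP->]; last 2 first.
- by apply/ffunP => i; rewrite !ffunE mul0r.
- by apply/ffunP => i; rewrite !ffunE mulr0.
have [_|/vec3_neq0[i vi]] := eqVneq v 0; first by right.
by left; move/ffunP/(_ i)/eqP: h; rewrite !ffunE mulf_eq0 (negPf vi) orbF.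
Qed.

Lemma dotC a b : dot a b = dot b a.
Proof. by apply: eq_bigr => i _; rewrite mulrC. Qed.

Lemma dot_scaler a x v : dot a (scale x v) = x * dot a v.
Proof. by rewrite /dot mulr_sumr; apply: eq_bigr => i _; rewrite ffunE mulrCA. Qed.

Lemma dot_scalel a x v : dot (scale x a) v = x * dot a v.
Proof. by rewrite dotC dot_scaler dotC. Qed.

Lemma dot_neq0 a : a != 0 -> exists c, dot a c = 1.
Proof.
move=> /vec3_neq0[i ai]; exists [ffun j => if j == i then (a i)^-1 else 0].
rewrite /dot (bigD1 i) //= ffunE eqxx mulfV // big1 ?addr0 // => j /negPf ji.
by rewrite ffunE ji mulr0.
Qed.

Lemma dot_crossl a b : dot a (cross a b) = 0.
Proof. by rewrite /dot sum3 !crossE; ring. Qed.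

Lemma dot_crossr a b : dot b (cross a b) = 0.
Proof. by rewrite /dot sum3 !crossE; ring. Qed.

Lemma cross_cross a b c : cross a (cross b c) = [ffun i => dot a c * b i - dot a b * c i].
Proof. by apply: vec3P; rewrite !ffunE /dot ?sum3 /= ?ffunE /=; ring. Qed.

Lemma cross_scale a x : cross a (scale x a) = 0.
Proof. by apply: vec3P; rewrite crossE !ffunE; ring. Qed.

Lemma cross_anti a b : cross a b = scale (-1) (cross b a).
Proof. by apply: vec3P; rewrite !ffunE /=; ring. Qed.

Lemma cross_eq0C a b : (cross a b == 0) = (cross b a == 0).
Proof. by rewrite cross_anti scale_eq0 oppr_eq0 oner_eq0. Qed.

Lemma cross0r a : cross a 0 = 0.
Proof. by apply: vec3P; rewrite !ffunE /=; ring. Qed.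

Lemma cross_eq0 a b : a != 0 -> cross a b = 0 -> exists x, b = scale x a.
Proof.
move=> /dot_neq0[c ac] ab0; exists (dot c b).
have := cross_cross c a b; rewrite ab0 cross0r => /ffunP h; apply/ffunP => i.
move: (h i); rewrite !ffunE [dot c a]dotC ac mul1r.
by move/esym/eqP; rewrite subr_eq0 => /eqP.
Qed.

Lemma dot_cross_neq0 a b : cross a b != 0 -> exists l, dot l a = 0 /\ dot l b = 1.
Proof.
move=> /dot_neq0[c]; set D := dot _ _ => D1; exists (cross c a); split.
  by rewrite dotC dot_crossr.
by rewrite -D1 /D /dot !sum3 !crossE; ring.
Qed.

Lemma dot_kernel_cross a P v : cross P v != 0 -> dot a P = 0 -> dot a v = 0 ->
  exists x, a = scale x (cross P v).
Proof.
move=> n0 aP av; apply: cross_eq0 => //; apply/eqP; rewrite cross_eq0C; apply/eqP.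
by rewrite cross_cross aP av; apply/ffunP => i; rewrite !ffunE !mul0r subrr.
Qed.

Definition lform a : {mpoly F[3]} := \sum_i a i *: 'X_i.

Lemma lform_homog a : lform a \is 1.-homog.
Proof. by rewrite rpred_sum // => i _; rewrite rpredZ // dhomogX /= mdeg1. Qed.

Lemma mmap_lform (A : comNzRingType) (iota : {rmorphism F -> A}) (h : 'I_3 -> A) a :
  mmap iota h (lform a) = \sum_i iota (a i) * h i.
Proof.
by rewrite rmorph_sum; apply: eq_bigr => i _ /=; rewrite mmapZ mmapX mmap1U.
Qed.

Lemma meval_lform v a : (lform a).@[v] = dot a v.
Proof. exact: (mmap_lform idfun). Qed.

Lemma on_line_lform P v a : on_line P v (lform a) = (dot a P)%:P + dot a v *: 'X.
Proof.
rewrite /on_line mmap_lform /dot !sum3 -!mul_polyC !polyCD !polyCM; ring.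
Qed.

Lemma lform_neq0 a : a != 0 -> lform a != 0.
Proof.
by move=> /dot_neq0[c ac]; apply: contraTneq isT => h; move: ac; rewrite -meval_lform h meval0 => /esym/eqP; rewrite oner_eq0.
Qed.

Lemma divides_mmap_sub (A : idomainType) (iota : {rmorphism F -> A}) (h h' : 'I_3 -> A) l f :
  (forall i, divides l (h i - h' i)) -> divides l (mmap iota h f - mmap iota h' f).
Proof.
move=> hh; rewrite /mmap -sumrB; apply: divides_sum => m _; rewrite -mulrBr; apply: divides_mulr.
have dM (x x' y y' : A) : divides l (x - x') -> divides l (y - y') -> divides l (x * y - x' * y').
  by move=> [s es] [t et]; exists (s * y + x' * t); rewrite mulrDl mulrAC -es -mulrA -et; ring.
have d0 : divides l (1 - 1) by exists 0; rewrite subrr mul0r.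
rewrite /mmap1; elim/big_rec2: _ => // i x y _ IH; apply: (dM) => //.
by elim: (m i) => [|k IHk]; rewrite ?expr0 // !exprS; apply: (dM).
Qed.

(** Cramer's rule: modulo the equation of the line, the generic point is [al P + be v] with linear
    forms [al] and [be], the error being that equation times [c]. Hence [f] is congruent to its
    binary form at [(al, be)], which is zero. *)
Lemma line_component P v d f : f \is d.-homog -> cross P v != 0 -> on_line P v f = 0 ->
  divides (lform (cross P v)) f.
Proof.
move=> fd /dot_neq0[c]; set D := dot _ _ => D1 f0.
pose al := lform (cross v c); pose be := lform (cross c P).
have := @divides_mmap_sub {mpoly F[3]} (@mpolyC 3 F) (fun i => 'X_i)
   (fun i => al * (P i)%:MP + be * (v i)%:MP) (lform (cross P v)) f.
rewrite (mmap_on_line _ _ _ _ _ fd) f0 /homogenise big1 => [|k _]; last first.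
  by rewrite coef0 rmorph0 !mul0r.
rewrite subr0 -(mmap_unique idfun) /=; apply => i.
exists (c i)%:MP; rewrite -[X in X - _]mul1r -mpolyC1 -D1 /D /al /be /lform /dot !sum3 !crossE -!mul_mpolyC.
move: i; apply: forall3; rewrite !(mpolyCD, mpolyCB, mpolyCM); ring.
Qed.

Lemma size_on_line P v d f : f \is d.-homog -> (size (on_line P v f) <= d.+1)%N.
Proof.
move=> fd; rewrite /on_line /mmap big_seq; apply: (leq_trans (size_sum _ _ _)).
apply/bigmax_leqP_seq => m mf _; rewrite /= mul_polyC (leq_trans (size_scale_leq _ _)) //.
rewrite -(homog_mdeg fd mf) mdegE /mmap1.
elim/big_rec2: _ => [|i p e _ sp]; first by rewrite size_poly1.
elim: (m i) => [|k IH]; first by rewrite expr0 mul1r.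
by rewrite exprS -mulrA mulrC addSn size_mul_linear.
Qed.

Lemma on_line_coef_deg P v d f : f \is d.-homog -> (on_line P v f)`_d = f.@[v].
Proof.
move=> fd; have := mmap_on_line idfun 0 1 P v fd.
rewrite /homogenise big_ord_recr /= subnn expr1n expr0 !mulr1 big1 ?add0r => [<-|k _].
  by apply: eq_mmap => // i; rewrite mul0r mul1r add0r.
by rewrite expr0n subn_eq0 leqNgt ltn_ord mulr0 mul0r.
Qed.

(** The coefficient is linear in [v] for constants and variables, and the Leibniz rule carries this
    over to products. *)
Lemma gradient_exists P f : exists g : vec3 F, forall v, (on_line P v f)`_1 = dot g v.
Proof.
pose G f := exists g : vec3 F, forall v, (on_line P v f)`_1 = dot g v.
have GD f1 f2 : G f1 -> G f2 -> G (f1 + f2).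
  move=> [g1 h1] [g2 h2]; exists [ffun i => g1 i + g2 i] => v.
  rewrite rmorphD coefD h1 h2 /dot -big_split; apply: eq_bigr => i _ /=.
  by rewrite ffunE mulrDl.
have GM f1 f2 : G f1 -> G f2 -> G (f1 * f2).
  move=> [g1 h1] [g2 h2]; exists [ffun i => f1.@[P] * g2 i + f2.@[P] * g1 i] => v.
  rewrite rmorphM coefM big_ord_recl big_ord1 /= subn0 subnn h1 h2 !on_line_coef0.
  by rewrite /dot !sum3 !ffunE; ring.
have GC x : G x%:MP.
  exists 0 => v; rewrite on_lineC coefC /dot big1 // => i _.
  by rewrite ffunE mul0r.
have GX i : G 'X_i.
  exists [ffun j => (j == i)%:R] => v; rewrite on_lineX coefD coefC coefZ coefX add0r mulr1.
  rewrite /dot (bigD1 i) //= ffunE eqxx mul1r big1 ?addr0 // => j /negPf ji.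
  by rewrite ffunE ji mul0r.
rewrite -/(G f) [f]mpolyE; elim/big_ind: _ => // [|m _]; first by rewrite -mpolyC0.
rewrite -mul_mpolyC mpolyXE_id; apply: (GM) => //; elim/big_ind: _ => // [|i _].
  by rewrite -mpolyC1.
by elim: (m i) => [|k IH]; rewrite ?expr0 -?mpolyC1 // exprS; apply: (GM).
Qed.

Lemma on_line_self P d f : f \is d.-homog -> f.@[P] = 0 -> on_line P P f = 0.
Proof.
move=> fd fP; rewrite /on_line (@eq_mmap _ _ _ _ polyC _ (fun i => (1 + 'X) * (P i)%:P)) //.
  rewrite (mmap_homog_scale _ _ _ fd).
  have e := rmorph_mmap idfun (@polyC F) P f.
  by rewrite [X in _ * X](_ : _ = (f.@[P])%:P) ?fP ?mulr0 // -fP [RHS]e; apply: eq_mmap.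
by move=> i; rewrite mulrDl mul1r mulrC mul_polyC.
Qed.

Lemma indep_direction P : P != 0 -> exists v, cross P v != 0.
Proof.
move=> P0; have [i Pi] := vec3_neq0 P0; move: i Pi; apply: forall3 => Pi.
  - exists [ffun i => (i == i1)%:R]; apply: contraNneq Pi => /ffunP/(_ i2).
    by rewrite !ffunE /= mulr1 mulr0 subr0 => ->.
  - exists [ffun i => (i == i2)%:R]; apply: contraNneq Pi => /ffunP/(_ i0).
    by rewrite !ffunE /= mulr1 mulr0 subr0 => ->.
  exists [ffun i => (i == i0)%:R]; apply: contraNneq Pi => /ffunP/(_ i1).
  by rewrite !ffunE /= mulr1 mulr0 subr0 => ->.
Qed.

(** When the gradient [g] is nonzero and [dot P e = 1], Euler's relation [dot g P = 0] turns
    [cross P (cross g e)] into [g]; so the direction [cross g e], which is orthogonal to [g], is not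
    proportional to [P]. *)
Lemma tangent_direction P d f : P != 0 -> f \is d.-homog -> f.@[P] = 0 ->
  exists2 v, cross P v != 0 & (on_line P v f)`_1 = 0.
Proof.
move=> P0 fd fP; have [g hg] := gradient_exists P f.
have gP : dot g P = 0 by rewrite -hg (on_line_self fd fP) coef0.
have [g0|g0] := eqVneq g 0.
  have [v Pv] := indep_direction P0; exists v => //.
  by rewrite hg g0 /dot big1 // => i _; rewrite ffunE mul0r.
have [e Pe] := dot_neq0 P0; exists (cross g e); last by rewrite hg dot_crossl.
suff -> : cross P (cross g e) = g by [].
rewrite cross_cross Pe dotC gP; apply/ffunP => i; rewrite ffunE; ring.
Qed.

End Vectors.

(** * Bezout's inequality for jets *)

Section Bezout.
Variable F : finFieldType.
Implicit Types (f h : {mpoly F[3]}).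

Lemma binom_deg k : ('C(k + 2, k) * 2 = (k + 2) * (k + 1))%N.
Proof.
have -> : 'C(k + 2, k) = 'C(k + 2, 2) by rewrite -bin_sub ?leq_addr // addKn.
by rewrite (bin_ffact _ 2) addn2 !ffactnS ffactn0 muln1 addn1.
Qed.

(** The forms of degree [k] have dimension [(k + 2) (k + 1) / 2], and the mixed second difference of
    this quadratic in steps [d] and [e] is [d e]: this is where the product of the degrees comes
    from. *)
Lemma jets_arith w d e M x1 x2 x3 x4 : (x1 + x2 = 'C(w + 2, w))%N ->
  (x3 <= 'C(w + d + e + 2, w + d + e))%N -> (x4 <= x2)%N ->
  (x4 + x3 = M + ('C(w + e + 2, w + e) + 'C(w + d + 2, w + d)))%N -> (M <= d * e)%N.
Proof.
have := binom_deg w; have := binom_deg (w + e); have := binom_deg (w + d); have := binom_deg (w + d + e).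
move: 'C(_, _) 'C(_, _) 'C(_, _) 'C(_, _) => b1 b2 b3 b4 h1 h2 h3 h4.
have E : ((w + 2) * (w + 1) + (w + d + e + 2) * (w + d + e + 1) =
          (w + e + 2) * (w + e + 1) + (w + d + 2) * (w + d + 1) + 2 * (d * e))%N by ring.
by move: E; rewrite -h1 -h2 -h3 -h4; move: (d * e)%N => de; lia.
Qed.

(** * The dimension count behind Bezout's inequality *)

Section Jets.
Variables (N r d e : nat) (f h : {mpoly F[3]}) (P v : 'I_N.+1 -> vec3 F).
Hypotheses (fd : f \is d.-homog) (he : h \is e.-homog) (f_prime : prime_elt f) (ndiv : ~ divides f h).
Hypotheses (jet_f : forall s, 'X^(r.+1) %| on_line (P s) (v s) f)
           (jet_h : forall s, 'X^(r.+1) %| on_line (P s) (v s) h).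

(** Chosen so that [A s * Q s c], of degree [N (r + 1) + (d + e) + r], has degree exactly
    [w + d + e]. *)
Let w := (N * r.+1 + r)%N.
Let m := (w + d + e)%N.

Variables (l : 'I_N.+1 -> 'I_N.+1 -> vec3 F) (lam mu : 'I_N.+1 -> vec3 F).
Hypothesis (l_P : forall s t, s != t -> dot (l s t) (P t) = 0 /\ dot (l s t) (P s) = 1).
Hypothesis (lamP : forall s, dot (lam s) (P s) = 0 /\ dot (lam s) (v s) = 1).
Hypothesis (muP : forall s, dot (mu s) (P s) = 1 /\ dot (mu s) (v s) = 0).

(** On the line at [s] the form [lam s] restricts to [X] and [mu s] to 1, so [Q s c] restricts to
    the polynomial with coefficients [c s]. As [A s] is nonzero at [P s] and vanishes to order
    [r + 1] along the line at every other point, jets at different points are prescribed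
    independently. *)
Let A s : {mpoly F[3]} := \prod_(t | t != s) lform (l s t) ^+ r.+1 * lform (mu s) ^+ (d + e).
Let Q s (c : 'M[F]_(N.+1, r.+1)) : {mpoly F[3]} :=
  \sum_(i < r.+1) c s i *: (lform (lam s) ^+ i * lform (mu s) ^+ (r - i)).

Let dom := ('M[F]_(N.+1, r.+1) * (dhomog 3 F (w + e) * dhomog 3 F (w + d)))%type.

(** A map into the forms of degree [m] whose kernel consists of the Koszul relations between [f] and
    [h]; comparing dimensions bounds the space of jets. *)
Let T (x : dom) : {mpoly F[3]} :=
  \sum_s A s * Q s x.1 + (x.2.1 : {mpoly F[3]}) * f + (x.2.2 : {mpoly F[3]}) * h.

Let lform_exp (a : vec3 F) k : lform a ^+ k \is k.-homog.
Proof. by rewrite -[X in X.-homog]mul1n; apply/dhomogMn/lform_homog. Qed.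

Let T_homog x : T x \is m.-homog.
Proof.
rewrite /T; apply: rpredD; first apply: rpredD.
- apply: rpred_sum => s _; have -> : m = (N * r.+1 + (d + e) + r)%N by rewrite /m /w; lia.
  apply: dhomogM; first apply: dhomogM => //.
    have -> : (N * r.+1 = \sum_(t | t != s) r.+1)%N.
      by rewrite sum_nat_const cardC1 card_ord.
    by elim/big_rec2: _ => [|t y1 y2 _ hy]; rewrite ?dhomog1 //; apply: dhomogM.
  apply: rpred_sum => i _; apply: rpredZ.
  by have := dhomogM (lform_exp (lam s) i) (lform_exp (mu s) (r - i)); rewrite subnKC // -ltnS.
- have -> : m = (w + e + d)%N by rewrite /m; lia.
  by apply: dhomogM => //; apply: dhomog_is_dhomog.
by apply: dhomogM => //; apply: dhomog_is_dhomog.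
Qed.

Let L (x : dom) : dhomog 3 F m := DHomog (T_homog x).

Let Q_linear s a c1 c2 : Q s (a *: c1 + c2) = a *: Q s c1 + Q s c2.
Proof.
rewrite /Q scaler_sumr -big_split; apply: eq_bigr => i _ /=.
by rewrite !mxE scalerDl scalerA.
Qed.

Let L_linear : linear L.
Proof.
move=> a x y; apply: val_inj; rewrite /= /T /=.
under eq_bigr => s _ do rewrite Q_linear mulrDr -scalerAr.
rewrite big_split /= -scaler_sumr.
rewrite -!mul_mpolyC; ring.
Qed.

HB.instance Definition _ := GRing.isLinear.Build F dom (dhomog 3 F m) _ L L_linear.

Let on_line_l s t : s != t -> 'X^(r.+1) %| on_line (P t) (v t) (lform (l s t) ^+ r.+1).
Proof.
move=> /l_P[l0 _]; rewrite rmorphXn /= on_line_lform l0 add0r exprZn -mul_polyC.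
exact: dvdp_mull.
Qed.

(** Modulo [X^(r + 1)] on the line at [s] only the term [A s * Q s] survives, and [A s] is
    invertible there because it does not vanish at [P s]. *)
Let ker_jets x : T x = 0 -> x.1 = 0.
Proof.
move=> Tx; apply/matrixP => s i; rewrite mxE.
have : on_line (P s) (v s) (T x) = 0 by rewrite Tx rmorph0.
rewrite /T !rmorphD !rmorphM rmorph_sum /= (bigD1 s) //= => /eqP; rewrite -!addrA addr_eq0 => /eqP E.
have : 'X^(r.+1) %| on_line (P s) (v s) (A s) * on_line (P s) (v s) (Q s x.1).
  rewrite -rmorphM /= E dvdpNr; apply: dvdp_add; last by apply: dvdp_add; apply: dvdp_mull.
  elim/big_ind: _ => [|? ?|t ts]; rewrite ?dvdp0 //; first exact: dvdp_add.
  rewrite rmorphM /A rmorphM rmorph_prod (bigD1 s) /= 1?eq_sym //.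
  by rewrite -!mulrA; apply/dvdp_mulr/on_line_l.
rewrite Gauss_dvdpr; last first.
  apply: coprimep_expl; rewrite coprimep_sym coprimepX rootE horner_coef0 on_line_coef0.
  rewrite /A mevalM rmorph_prod mulf_neq0 //=.
    apply/prodf_neq0 => t; rewrite eq_sym => st.
    by rewrite rmorphXn /= meval_lform (l_P st).2 expr1n oner_eq0.
  by rewrite rmorphXn /= meval_lform (muP s).1 expr1n oner_eq0.
have -> : on_line (P s) (v s) (Q s x.1) = \poly_(i < r.+1) x.1 s (inord i).
  rewrite poly_def rmorph_sum /=; apply: eq_bigr => j _.
  rewrite -mul_mpolyC rmorphM /= on_lineC mul_polyC rmorphM !rmorphXn /= !on_line_lform.
  by rewrite (lamP s).1 (lamP s).2 (muP s).1 (muP s).2 scale0r addr0 add0r scale1r expr1n mulr1 inord_val.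
set p := \poly_(_ < _) _ => dvp.
have p0 : p = 0.
  apply/eqP; apply: contraTT dvp => p0; apply/negP => /(dvdp_leq p0).
  by rewrite size_polyXn leqNgt ltnS size_poly.
have := congr1 (fun p : {poly F} => p`_i) p0.
by rewrite coef_poly ltn_ord coef0 inord_val.
Qed.

Let K (y : dhomog 3 F w) : {mpoly F[3]} * {mpoly F[3]} := (- ((y : {mpoly F[3]}) * h), (y : {mpoly F[3]}) * f).

Let K_homog y : (K y).1 \is (w + e).-homog /\ (K y).2 \is (w + d).-homog.
Proof. by split; rewrite ?rpredN; apply: dhomogM => //; apply: dhomog_is_dhomog. Qed.

Let K' (y : dhomog 3 F w) : dom := (0, (DHomog (K_homog y).1, DHomog (K_homog y).2)).

Let K'_linear : linear K'.
Proof.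
move=> a x y; rewrite /K' /=; congr (_, (_, _)).
- by rewrite /= scaler0 addr0.
- by apply: val_inj; rewrite /= -!mul_mpolyC; ring.
by apply: val_inj; rewrite /= -!mul_mpolyC; ring.
Qed.

HB.instance Definition _ := GRing.isLinear.Build F (dhomog 3 F w) dom _ K' K'_linear.

(** In [a f + b h = 0] the prime [f] divides [b], as it does not divide [h]; the quotient is
    homogeneous of degree [w] and generates the relation. *)
Let ker_L x : L x = 0 -> exists y, x = K' y.
Proof.
move=> /(congr1 val) /= Tx; have x1 := ker_jets Tx.
case: x x1 Tx => c [[a ha] [b hb]] /= c0; rewrite /T /= big1 => [|s _]; last first.
  by rewrite /Q big1 ?mulr0 // => i _; rewrite c0 mxE scale0r.
rewrite add0r c0 => E; have [f0 fu fp] := f_prime.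
have dfb : divides f (b * h).
  by exists (- a); rewrite mulNr; apply/eqP; rewrite -subr_eq0 opprK addrC E.
case: (fp _ _ dfb) => // -[y by_]; have [y0|y0] := eqVneq y 0.
  exists 0; congr (_, (_, _)); apply: val_inj; rewrite /= mul0r ?oppr0.
    by move/eqP: E; rewrite by_ y0 !mul0r addr0 mulf_eq0 (negPf f0) orbF => /eqP.
  by rewrite by_ y0 mul0r.
have [d1 d1w [hy hf]] := @homog_factorl F 3 y f (w + d) ltac:(by rewrite mulf_neq0) ltac:(by rewrite -by_).
have ed := dhomog_uniq f0 hf fd; have ew : d1 = w by lia.
  rewrite ew in hy; exists (DHomog hy); congr (_, (_, _)); apply: val_inj => //=.
  apply: (mulIf f0); apply/eqP; rewrite -subr_eq0; apply/eqP; rewrite -[RHS]E by_; ring.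
Qed.

Lemma jets_bound_aux : (N.+1 * r.+1 <= d * e)%N.
Proof.
pose LL := linfun L; pose KK := linfun K'.
have kerK : (lker LL <= limg KK)%VS.
  apply/subvP => x; rewrite memv_ker lfunE /= => /eqP/ker_L[y ->].
  by rewrite -(lfunE K') memv_img // memvf.
have := limg_ker_dim LL fullv; rewrite capfv.
have := dimvS kerK; have := dimvS (subvf (limg LL)).
have := limg_ker_dim KK fullv; rewrite !dimvf.
have dk k : dim (dhomog 3 F k) = 'C(k + 2, k) by [].
have -> : dim dom = (N.+1 * r.+1 + ('C(w + e + 2, w + e) + 'C(w + d + 2, w + d)))%N by [].
rewrite !dk => hK hL hKL hD; exact: (jets_arith hK hL hKL hD).
Qed.

End Jets.

(* The forms of large degree surject onto the jets, while those in the ideal [(f, h)] have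
   codimension [d * e]. *)
Lemma bezout_jets N r d e f h (P v : 'I_N -> vec3 F) :
  f \is d.-homog -> h \is e.-homog -> prime_elt f -> ~ divides f h ->
  (forall s t, s != t -> cross (P s) (P t) != 0) -> (forall s, cross (P s) (v s) != 0) ->
  (forall s, 'X^r %| on_line (P s) (v s) f) -> (forall s, 'X^r %| on_line (P s) (v s) h) ->
  (N * r <= d * e)%N.
Proof.
case: N P v => [|N] P v fd he fp ndiv Pn vi jf jh; first by rewrite mul0n.
case: r jf jh => [|r] jf jh; first by rewrite muln0.
have [l lP] : exists l : 'I_N.+1 -> 'I_N.+1 -> vec3 F,
    forall s t, s != t -> dot (l s t) (P t) = 0 /\ dot (l s t) (P s) = 1.
  have [l hl] : exists l : {ffun 'I_N.+1 * 'I_N.+1 -> vec3 F}, forall st,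
      st.1 != st.2 -> dot (l st) (P st.2) = 0 /\ dot (l st) (P st.1) = 1.
    have [|l hl] := @fin_all_exists _ (fun=> vec3 F) (fun (st : 'I_N.+1 * 'I_N.+1) a =>
        st.1 != st.2 -> dot a (P st.2) = 0 /\ dot a (P st.1) = 1).
      move=> [s t] /=; have [->|st] := eqVneq s t; first by exists 0.
      have /dot_cross_neq0[a ha] : cross (P t) (P s) != 0 by apply: Pn; rewrite eq_sym.
      by exists a.
    by exists (finfun l) => st; rewrite ffunE; apply: hl.
  by exists (fun s t => l (s, t)) => s t; apply: (hl (s, t)).
have [lam lamP] := fin_all_exists (fun s => dot_cross_neq0 (vi s)).
have [s|mu muP] := @fin_all_exists _ (fun=> vec3 F) (fun s a => dot a (P s) = 1 /\ dot a (v s) = 0).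
  have [|a [a1 a2]] := @dot_cross_neq0 F (v s) (P s); first by rewrite cross_eq0C.
  by exists a.
have := jets_bound_aux fd he fp ndiv jf jh lP lamP muP.
by [].
Qed.

End Bezout.

(** * Rational points *)

Section Points.
Variable F : finFieldType.
Implicit Types (a b c u v w P Q R : vec3 F) (x y t : F) (f g : {mpoly F[3]}).
Local Notation q := #|F|.

Lemma proj_classP v w : reflect (exists2 x, x != 0 & w = scale x v) (w \in proj_class v).
Proof.
apply: (iffP imsetP) => [[x]|[x x0 ->]]; first by rewrite inE => x0 ->; exists x.
by exists x; rewrite ?inE.
Qed.

Lemma scaleA x y v : scale x (scale y v) = scale (x * y) v.
Proof. by apply/ffunP => i; rewrite !ffunE mulrA. Qed.

Lemma scale1 v : scale 1 v = v.
Proof. by apply/ffunP => i; rewrite !ffunE mul1r. Qed.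

Lemma proj_class_scale x v : x != 0 -> proj_class (scale x v) = proj_class v.
Proof.
move=> x0; apply/setP => w; apply/proj_classP/proj_classP => -[y y0 ->].
  by exists (y * x); rewrite ?mulf_neq0 // scaleA.
by exists (y / x); rewrite ?mulf_neq0 ?invr_eq0 // scaleA divfK.
Qed.

(** The choice depends only on the class, so proportional vectors share a representative; projective
    points can then be counted as vectors. The default is never reached, since [v] lies in its own
    class. *)
Definition rep v : vec3 F := odflt v [pick w in proj_class v].

Lemma rep_mem v : rep v \in proj_class v.
Proof.
rewrite /rep; case: pickP => [w //|/(_ v)/negP[]].
by apply/proj_classP; exists 1; rewrite ?oner_eq0 ?scale1.
Qed.

Lemma repE v : exists2 x, x != 0 & rep v = scale x v.
Proof. exact/proj_classP/rep_mem. Qed.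

Lemma rep_scale x v : x != 0 -> rep (scale x v) = rep v.
Proof.
move=> x0; rewrite /rep proj_class_scale //; case: pickP => [w //|/(_ v)/negP[]].
by apply/proj_classP; exists 1; rewrite ?oner_eq0 ?scale1.
Qed.

Definition points : {set vec3 F} := [set v : vec3 F | (v != 0) && (rep v == v)].

Lemma points_neq0 v : v \in points -> v != 0.
Proof. by rewrite inE => /andP[]. Qed.

Lemma rep_point v : v != 0 -> rep v \in points.
Proof.
move=> v0; have [x x0 e] := repE v.
by rewrite inE e rep_scale // e eqxx scale_eq0 negb_or x0 v0.
Qed.

Lemma points_rep v : v \in points -> rep v = v.
Proof. by rewrite inE => /andP[_ /eqP]. Qed.

Lemma points_scale v w x : v \in points -> w \in points -> v = scale x w -> v = w.
Proof.
move=> vp wp e; rewrite -(points_rep vp) -(points_rep wp) e rep_scale //.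
by apply: contraTneq (points_neq0 vp) => x0; rewrite e x0 scale_eq0 eqxx.
Qed.

Lemma points_cross v w : v \in points -> w \in points -> v != w -> cross v w != 0.
Proof.
move=> vp wp; apply: contraNneq => /(cross_eq0 (points_neq0 vp))[x e].
by apply/eqP/esym; apply: points_scale e.
Qed.

Definition scale_invariant (S : pred (vec3 F)) := forall x v, x != 0 -> S (scale x v) = S v.

Lemma card_scale_invariant S : scale_invariant S ->
  #|[set v : vec3 F | (v != 0) && S v]| = (q.-1 * #|[set v in points | S v]|)%N.
Proof.
move=> hS; have -> : q.-1 = #|[set~ (0 : F)]| by rewrite cardsC1.
rewrite -cardsX -(@card_in_imset _ _ (fun z => scale z.1 z.2)); last first.
  move=> [x v] [y w] /=; rewrite !inE /= => /andP[x0 /andP[/andP[v0 /eqP rv] _]] /andP[y0 /andP[/andP[w0 /eqP rw] _]] e.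
  have vw : v = w by rewrite -rv -rw -(rep_scale v x0) e rep_scale.
  congr (_, _) => //; move: e; rewrite vw => /ffunP e; have [i wi] := vec3_neq0 w0.
  by have := e i; rewrite !ffunE; apply: mulIf.
congr #|pred_of_set _|; apply/setP => v; apply/idP/imsetP.
  rewrite inE => /andP[v0 Sv]; have [x x0 e] := repE v.
  exists (x^-1, rep v); last by rewrite /= e scaleA mulVf // scale1.
  by rewrite !inE /= invr_eq0 x0 /= e hS // Sv rep_scale // e eqxx scale_eq0 negb_or x0 v0.
by case=> -[x w] /=; rewrite !inE /= => /andP[x0 /andP[/andP[w0 _] Sw]] ->; rewrite scale_eq0 negb_or x0 w0 hS.
Qed.

Definition zeros f : {set vec3 F} := [set v in points | f.@[v] == 0].

Lemma meval_scale d f x v : f \is d.-homog -> f.@[scale x v] = x ^+ d * f.@[v].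
Proof.
move=> fd; rewrite -(mmap_homog_scale idfun v x fd).
by apply: eq_mmap => // i; rewrite ffunE.
Qed.

Lemma zeros_invariant d f : f \is d.-homog -> scale_invariant (fun v => f.@[v] == 0).
Proof. by move=> fd x v x0; rewrite (meval_scale _ _ fd) mulf_eq0 expf_eq0 (negPf x0) andbF. Qed.

Lemma npointsE d f : f \is d.-homog -> npoints f = #|zeros f|.
Proof.
move=> fd; rewrite /npoints -(@card_in_imset _ _ (@proj_class F)) => [|v w]; last first.
  rewrite !inE => /andP[vp _] /andP[wp _] e.
  have : w \in proj_class v by rewrite e; apply/proj_classP; exists 1; rewrite ?oner_eq0 ?scale1.
  by case/proj_classP => x _ /points_scale ->; rewrite ?inE.
congr #|pred_of_set _|; apply/setP => C; apply/imsetP/imsetP => -[v]; rewrite !inE.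
  case/andP => v0 fv ->; have [x x0 e] := repE v.
  exists (rep v); last by rewrite e proj_class_scale.
  by rewrite inE rep_point // e (zeros_invariant fd) //.
by case/andP => /andP[v0 _] fv ->; exists v; rewrite ?inE ?v0.
Qed.

Lemma dotDr a v w : dot a (v + w) = dot a v + dot a w.
Proof. by rewrite /dot -big_split; apply: eq_bigr => i _; rewrite !ffunE mulrDr. Qed.

Lemma card_vec3 : #|{: vec3 F}| = (q ^ 3)%N.
Proof. by rewrite card_ffun card_ord. Qed.

Lemma card_plane a : a != 0 -> #|[set v : vec3 F | dot a v == 0]| = (q ^ 2)%N.
Proof.
move=> /dot_neq0[c ac].
have fib x : #|[set v : vec3 F | dot a v == x]| = #|[set v : vec3 F | dot a v == 0]|.
  rewrite -[RHS](card_imset _ (addrI (scale x c))); apply: eq_card => v; rewrite [LHS]inE.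
  apply/eqP/imsetP => [avx|[w]]; last first.
    by rewrite inE => /eqP aw ->; rewrite dotDr dot_scaler ac aw mulr1 addr0.
  exists (v - scale x c); last by rewrite addrC subrK.
  rewrite inE; have := dotDr a (v - scale x c) (scale x c).
  by rewrite subrK avx dot_scaler ac mulr1 => /eqP; rewrite -subr_eq subrr eq_sym.
have : (q ^ 3 = q * #|[set v : vec3 F | dot a v == 0%R]|)%N.
  rewrite -card_vec3 -[LHS]sum1_card (partition_big (dot a) predT) //=.
  rewrite (eq_bigr (fun=> #|[set v : vec3 F | dot a v == 0]|)) => [|x _].
    by rewrite sum_nat_const.
  by rewrite -(fib x) -sum1_card; apply: eq_bigl => v; rewrite inE.
rewrite expnS => /eqP; rewrite eqn_pmul2l; first by move/eqP.
by rewrite (ltn_trans _ (finNzRing_gt1 F)).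
Qed.

Definition line a : {set vec3 F} := [set v in points | dot a v == 0].

Lemma line_invariant a : scale_invariant (fun v => dot a v == 0).
Proof. by move=> x v x0; rewrite dot_scaler mulf_eq0 (negPf x0). Qed.

Lemma card_without0 (S : pred (vec3 F)) : S 0 -> #|[set v : vec3 F | S v]| = #|[set v : vec3 F | (v != 0) && S v]|.+1.
Proof.
move=> S0; rewrite (cardsD1 (0 : vec3 F)) inE S0; congr _.+1; apply: eq_card => v.
by rewrite !inE.
Qed.

Lemma card_line a : a != 0 -> #|line a| = q.+1.
Proof.
move=> a0; have := card_scale_invariant (line_invariant a); rewrite -/(line a).
have := card_plane a0; rewrite (@card_without0 (fun v => dot a v == 0)); last first.
  by rewrite /dot big1 // => i _; rewrite ffunE mulr0.
move=> e h; have := finNzRing_gt1 F; move: e h; case: q => [//|[//|n]] /= e h _.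
by apply/eqP; rewrite -(eqn_pmul2l (ltn0Sn n)) -h; apply/eqP; move: e; rewrite !expnS expn0; nia.
Qed.

Lemma card_points : #|points| = (q ^ 2 + q + 1)%N.
Proof.
have := @card_scale_invariant xpredT (fun _ _ _ => erefl).
rewrite (_ : [set v in points | true] = points); last by apply/setP => v; rewrite inE andbT.
have := card_vec3; rewrite -cardsT (@card_without0 xpredT) //.
move=> e h; have := finNzRing_gt1 F; move: e h; case: q => [//|[//|n]] /= e h _.
by apply/eqP; rewrite -(eqn_pmul2l (ltn0Sn n)) -h; apply/eqP; move: e; rewrite !expnS expn0; nia.
Qed.

End Points.

(** * Sziklai's bound *)

Section Sziklai.
Variable F : finFieldType.
Implicit Types (a b c l u v w P Q R : vec3 F) (x y t : F) (f g h : {mpoly F[3]}).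
Local Notation q := #|F|.

Lemma scaleDr x v w : scale x (v + w) = scale x v + scale x w.
Proof. by apply/ffunP => i; rewrite !ffunE mulrDr. Qed.

Lemma scaleDl x y v : scale (x + y) v = scale x v + scale y v.
Proof. by apply/ffunP => i; rewrite !ffunE mulrDl. Qed.

Lemma scale0 v : scale 0 v = 0.
Proof. by apply/ffunP => i; rewrite !ffunE mul0r. Qed.

Lemma scale_inj v x y : v != 0 -> scale x v = scale y v -> x = y.
Proof.
by move=> /vec3_neq0[i vi] /ffunP/(_ i); rewrite !ffunE; apply: mulIf.
Qed.

(* Projection from [P] to a line [l] not through [P]. *)
Lemma pencil S P l : scale_invariant S -> P \in points F -> dot l P != 0 ->
  #|[set v in points F | S v] :\ P| = (\sum_(R in line l) #|[set t | S (R + scale t P)%R]|)%N.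
Proof.
move=> hS Pp lP; have P0 := points_neq0 Pp.
pose B := [set z : vec3 F * F | (z.1 \in line l) && S (z.1 + scale z.2 P)].
have -> : (\sum_(R in line l) #|[set t | S (R + scale t P)%R]|)%N = #|B|.
  rewrite -[RHS]sum1_card.
  under eq_bigr => R _ do rewrite -sum1_card.
  rewrite pair_big_dep /=; apply: eq_bigl => z; by rewrite !inE.
have dl R t : R \in line l -> dot l (R + scale t P) = t * dot l P.
  by rewrite inE => /andP[_ /eqP lR]; rewrite dotDr lR add0r dot_scaler.
have nz R t : R \in line l -> R + scale t P != 0.
  move=> Rl; apply/eqP => e; have := dl R t Rl; rewrite e.
  have -> : dot l 0 = 0 by rewrite /dot big1 // => i _; rewrite ffunE mulr0.
  move/esym/eqP; rewrite mulf_eq0 (negPf lP) orbF => /eqP t0.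
  by move: e Rl; rewrite t0 scale0 addr0 => ->; rewrite !inE eqxx.
rewrite -(@card_in_imset _ _ (fun z : vec3 F * F => rep (z.1 + scale z.2 P : vec3 F))) => [|[R t] [R' t']]; last first.
  rewrite !inE /= => /andP[Rl _] /andP[Rl' _] e.
  have [x x0 ex] := repE (R + scale t P); have [y y0 ey] := repE (R' + scale t' P).
  have E : R' + scale t' P = scale (y^-1 * x) R + scale (y^-1 * x * t) P.
    by rewrite -[scale (_ * t) P]scaleA -scaleDr -scaleA -ex e ey scaleA mulVf // scale1.
  move: (y^-1 * x) E => z E.
  have Rl1 : R \in line l by rewrite !inE. have Rl1' : R' \in line l by rewrite !inE.
  have tt : t' = z * t.
    apply: (mulIf lP); rewrite -(dl R' t') // E dotDr !dot_scaler.
    by move: Rl => /andP[_ /eqP ->]; rewrite mulr0 add0r.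
  move: E; rewrite tt => /addIr ER.
  have RR : R' = R by apply: (points_scale _ _ ER); rewrite inE; [case/andP: Rl' | case/andP: Rl].
  have R0 : R != 0 by case/andP: Rl => /andP[].
  have z1 : z = 1 by apply: (@scale_inj R) => //; rewrite scale1 -ER.
  by rewrite RR z1 mul1r.
apply: eq_card => v; rewrite 3![in LHS]inE; apply/idP/imsetP.
  case/andP => vP /andP[vp Sv]; pose t := dot l v / dot l P; pose R := v - scale t P.
  have R0 : R != 0.
    by apply: contraNneq vP => /eqP; rewrite subr_eq0 => /eqP e; apply/eqP/(points_scale vp Pp e).
  have [y y0 ey] := repE R; exists (rep R, y * t); last first.
    by rewrite /= ey -scaleA -scaleDr subrK rep_scale // (points_rep vp).
  rewrite inE /= ey -scaleA -scaleDr subrK hS // Sv andbT -ey inE rep_point // ey (line_invariant l) //=.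
  rewrite /R; have := dotDr l (v - scale t P) (scale t P).
  by rewrite subrK dot_scaler /t divfK // => /eqP; rewrite -subr_eq subrr eq_sym.
case=> -[R t]; rewrite inE /= => /andP[Rl SR] ->; have [y y0 ey] := repE (R + scale t P).
rewrite rep_point ?nz // ey hS // SR andbT -ey !andbT; apply/eqP => e.
have E : R = scale (y^-1 - t) P.
  by rewrite scaleDl -{1}e ey scaleA mulVf // scale1 -addrA -scaleDl subrr scale0 addr0.
have := dl R 0 Rl; rewrite scale0 addr0 mul0r E dot_scaler => /eqP.
rewrite mulf_eq0 (negPf lP) orbF => /eqP e0; move: Rl; rewrite E e0 scale0 !inE eqxx //.
Qed.

Lemma horner_on_line_scale P R t f : f.@[R + scale t P] = (on_line R P f).[t].
Proof. by rewrite horner_on_line; apply: meval_eq => i; rewrite !ffunE mulrC. Qed.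

(** Both restrictions come from one binary form on the line through [P] and [R]; exchanging the two
    points reverses its coefficients. *)
Lemma on_line_rev P R d k f : f \is d.-homog -> (k <= d)%N ->
  (on_line R P f)`_(d - k) = (on_line P R f)`_k.
Proof.
move=> fd kd; have := mmap_on_line (@polyC F) 'X 1 P R fd.
rewrite /homogenise (_ : mmap _ _ f = on_line R P f) => [->|]; last first.
  by apply: eq_mmap => // i; rewrite mul1r addrC -mul_polyC mulrC.
rewrite coef_sum (bigD1 (Ordinal (kd : (k < d.+1)%N))) //= big1 ?addr0 => [|i].
  by rewrite expr1n mulr1 coefCM coefXn eqxx mulr1.
rewrite -val_eqE /= expr1n mulr1 coefCM coefXn => ik.
have := ltn_ord i; case: eqP; rewrite ?mulr0 // => e h; move: ik; lia.
Qed.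

Definition no_line f := forall a, a != 0 -> ~ divides (lform a) f.

Lemma no_line_neq0 P v d f : no_line f -> f \is d.-homog -> cross P v != 0 -> on_line P v f != 0.
Proof. by move=> nl fd Pv; apply/eqP => /(line_component fd Pv)/nl; apply. Qed.

Lemma line_cross_neq0 P R l : P \in points F -> dot l P != 0 -> R \in line l -> cross R P != 0.
Proof.
move=> Pp lP; rewrite inE => /andP[Rp /eqP lR]; apply: points_cross => //.
by apply: contraNneq lP => <-; rewrite lR.
Qed.

Lemma card_roots_lt (p : {poly F}) : p != 0 -> (#|[set t | p.[t] == 0%R]| < size p)%N.
Proof.
move=> p0; rewrite cardE; apply: max_poly_roots => //; last exact: enum_uniq.
by apply/allP => t; rewrite mem_enum inE.
Qed.

Lemma zeros_pencil_bound P l d f m : f \is d.-homog -> P \in points F -> dot l P != 0 ->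
  (forall R, R \in line l -> (#|[set t | (on_line R P f).[t] == 0%R]| <= m)%N) ->
  (#|zeros f| <= 1 + q.+1 * m)%N.
Proof.
move=> fd Pp lP hm; rewrite (cardsD1 P) leq_add ?leq_b1 //.
rewrite (pencil (zeros_invariant fd) Pp lP).
have l0 : l != 0.
  by apply: contraNneq lP => ->; rewrite /dot big1 // => i _; rewrite ffunE mul0r.
rewrite -(card_line l0) -sum_nat_const; apply: leq_sum => R Rl.
apply: leq_trans (hm R Rl); apply: subset_leq_card; apply/subsetP => t.
by rewrite !inE horner_on_line_scale.
Qed.

(** Parametrised from [R], the line has [P] at infinity; a point of multiplicity at least 2 there
    lowers the degree of the restriction to at most [d - 2]. *)
Lemma singular_bound P d f : no_line f -> f \is d.-homog -> (1 < d)%N -> P \in points F ->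
  f.@[P] = 0 -> (forall v, (on_line P v f)`_1 = 0) -> (#|zeros f| <= 1 + q.+1 * (d - 2))%N.
Proof.
move=> nl fd d1 Pp fP f1; have [l lP] := dot_neq0 (points_neq0 Pp).
rewrite dotC in lP; have lP0 : dot l P != 0 by rewrite lP oner_eq0.
apply: (zeros_pencil_bound fd Pp lP0) => R Rl.
have RP := line_cross_neq0 Pp lP0 Rl; have p0 := no_line_neq0 nl fd RP.
rewrite -ltnS; apply: leq_trans (card_roots_lt p0) _.
apply/leq_sizeP => j dj; have [jd|jd] := leqP j d; last first.
  by rewrite nth_default // (leq_trans (size_on_line _ _ fd)).
have e : (d - (d - j))%N = j by lia.
rewrite -e on_line_rev ?leq_subr //; have : (d - j <= 1)%N by lia.
by case: (d - j)%N => [|[|//]] _; rewrite ?f1 // on_line_coef0.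
Qed.

Lemma unit_homog f : divides f 1 -> f \is 0.-homog.
Proof.
case=> g e; have [||d1 d10 [_]] := @homog_factorl F 3 g f 0; rewrite -?e ?oner_eq0 //.
exact: dhomog1.
Qed.

Lemma homog0_unit f : f != 0 -> f \is 0.-homog -> divides f 1.
Proof.
move=> f0 /dhomogP h; have fC : f = (f@_0%MM)%:MP.
  apply/mpolyP => m; rewrite mcoeffC; have [->|m0] := eqVneq m 0%MM; first by rewrite ?eqxx mulr1.
  rewrite mulr0; apply: memN_msupp_eq0; apply: contraNN m0 => /h /= /eqP.
  by rewrite mdeg_eq0.
have c0 : f@_0%MM != 0 by apply: contraNneq f0 => z; rewrite fC z mpolyC0.
by exists ((f@_0%MM)^-1)%:MP; rewrite {2}fC -mpolyCM mulVf.
Qed.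

Lemma homog1_lform f : f \is 1.-homog -> exists a, f = lform a.
Proof.
move=> /dhomogP h; exists [ffun i => f@_(U_(i))%MM].
apply/mpolyP => m; rewrite /lform raddf_sum /=.
have [e|m1] := eqVneq (mdeg m) 1%N.
  have /mdeg1P[i /eqP ->] : mdeg m == 1%N by rewrite e.
  rewrite (bigD1 i) //= ffunE mcoeffZ mcoeffX eqxx mulr1 big1 ?addr0 // => j ji.
  by rewrite mcoeffZ mcoeffX eq_mnm1 (negPf ji) mulr0.
rewrite memN_msupp_eq0; last by apply: contraNN m1 => /h /= ->.
rewrite big1 // => i _; rewrite mcoeffZ mcoeffX; case: eqP => [E|]; rewrite ?mulr0 //.
by rewrite -E mdeg1 in m1.
Qed.

End Sziklai.

Section Sziklai2.
Variable F : finFieldType.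
Implicit Types (a b c l u v w P Q R : vec3 F) (x y t : F) (f g h : {mpoly F[3]}).
Local Notation q := #|F|.

Lemma no_line_factorl f g : no_line (f * g) -> no_line f.
Proof. by move=> h a a0 [c e]; apply: (h a a0); exists (g * c); rewrite e; ring. Qed.

Lemma no_line_factorr f g : no_line (f * g) -> no_line g.
Proof. by rewrite mulrC; apply: no_line_factorl. Qed.

Lemma no_line_deg1 f : f != 0 -> f \is 1.-homog -> ~ no_line f.
Proof.
move=> f0 /homog1_lform[a fa] nl; apply: (nl a); last by exists 1; rewrite mul1r.
by apply: contraNneq f0 => a0; rewrite fa a0 /lform big1 // => i _; rewrite ffunE scale0r.
Qed.

Lemma lowest_coef (p : {poly F}) : p != 0 ->
  exists j, [/\ (j < size p)%N, p`_j != 0 & forall i, (i < j)%N -> p`_i = 0].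
Proof.
move=> p0; have ex : exists j, p`_j != 0 by exists (size p).-1; rewrite -lead_coefE lead_coef_eq0.
case: (ex_minnP ex) => j pj mj; exists j; split=> //.
  by rewrite ltnNge; apply: contraNN pj => h; rewrite nth_default.
by move=> i; rewrite ltnNge => h; apply/eqP; apply: contraNT h => /mj.
Qed.

(** After multiplication by [k + 1] the slack is exactly [(d - k - 1) (Q - 1 - d)], that is
    [e1 * e2] below. *)
Lemma sziklai_arith (N k d Q : nat) : (N * k.+1 <= d * (d + k * Q.-1))%N -> (k < d)%N -> (d < Q)%N ->
  (N <= (d - 1) * Q + 1)%N.
Proof.
move=> h kd dQ; rewrite -(leq_pmul2r (ltn0Sn k)); apply: leq_trans h _.
case: Q dQ => [//|Q]; rewrite ltnS => dQ; rewrite /=.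
have [e1 de] : exists e1, d = (k + e1).+1 by exists (d - k.+1)%N; lia.
subst d.
have [e2 ->] : exists e2, Q = (k + e1 + e2).+1 by exists (Q - (k + e1).+1)%N; lia.
rewrite subn1 /=; set lhs := (X in (X <= _)%N).
by rewrite (_ : (_ * _)%N = (lhs + e1 * e2)%N) ?leq_addr // /lhs; ring.
Qed.

Lemma irred_bound d f : irred_elt f -> f \is d.-homog -> no_line f -> (1 < d)%N -> (d < q)%N ->
  (#|zeros f| <= (d - 1) * q + 1)%N.
Proof.
move=> fI fd nl d1 dq; have fp := mpoly_irred_prime fI.
have [Z0|[P0 P0Z]] := set_0Vmem (zeros f); first by rewrite Z0 cards0.
have ZP P : P \in zeros f -> P \in points F /\ f.@[P] = 0.
  by rewrite inE => /andP[Pp /eqP].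
case: (classic (exists2 P, P \in zeros f & forall v, (on_line P v f)`_1 = 0)) => [[P PZ sing]|nsing].
  have [Pp fP] := ZP _ PZ; apply: leq_trans (singular_bound nl fd d1 Pp fP sing) _.
  by case: d d1 dq {fd} => [|[|d]] // _; rewrite subn1 subn2 /=; move: q => Q dQ; nia.
have tang P : P \in zeros f -> exists v u j, [/\ cross P v != 0, (on_line P u f)`_1 != 0,
    (1 < j <= d)%N, (on_line P v f)`_j != 0 & forall i, (i < j)%N -> (on_line P v f)`_i = 0].
  move=> PZ; have [Pp fP] := ZP _ PZ.
  have [v Pv v1] := tangent_direction (points_neq0 Pp) fd fP.
  have [u u1] : exists u, (on_line P u f)`_1 != 0.
    apply: NNPP => h; apply: nsing; exists P => // w; apply/eqP; rewrite -[_ == _]negbK.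
    by apply/negP => w1; apply: h; exists w.
  have [j [js jn jl]] := lowest_coef (no_line_neq0 nl fd Pv).
  exists v, u, j; split=> //; apply/andP; split; last first.
    by rewrite -ltnS; apply: leq_trans js (size_on_line _ _ fd).
  by case: j jn {js jl} => [|[|//]]; rewrite ?v1 ?eqxx // on_line_coef0 fP eqxx.
(* If [f] divided all its polars, the contact order at [P0] would exceed [d + 1], although it is at
   most [d]. The least bad index is written [k.+1]. *)
have [k [nk hk]] : exists k, ~ divides f (polar k.+1 f) /\ forall i, (i < k)%N -> divides f (polar i.+1 f).
  apply: first_failure => all; have [v [u [j [_ u1 /andP[j1 jd] jn jl]]]] := tang _ P0Z.
  have : (d.+1 < j)%N; last by lia.
  by apply: (tangent_order fd jd (ZP _ P0Z).2 u1 j1 jl jn) => -[|i] // _; apply: all.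
have hdiv i : (0 < i < k.+1)%N -> divides f (polar i f) by case: i => // i /hk.
have jets (s : 'I_#|zeros f|) : exists v, [/\ cross (enum_val s) v != 0, (k.+1 < d)%N,
    'X^(k.+2) %| on_line (enum_val s) v f & 'X^(k.+2) %| on_line (enum_val s) v (polar k.+1 f)].
  have sZ := enum_valP s; have [v [u [j [Pv u1 /andP[j1 jd] jn jl]]]] := tang _ sZ.
  have kj : (k.+1 < j)%N := tangent_order fd jd (ZP _ sZ).2 u1 j1 jl jn hdiv.
  have dvd i : 'X^(k.+2) %| on_line (enum_val s) v (polar i f).
    have [r -> _] := polar_low_order i fd jd jl.
    by apply: dvdp_mulr; rewrite dvdp_exp2l.
  by exists v; split=> //; [lia | have := dvd 0%N; rewrite polar0].
have [v hv] := fin_all_exists jets.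
have [_ kd _ _] := hv (enum_rank_in P0Z P0).
apply: (sziklai_arith (k := k.+1) _ kd dq).
apply: (@bezout_jets F #|zeros f| k.+2 d _ f (polar k.+1 f) (fun s => enum_val s) v) => //.
- exact: polar_homog.
- move=> s t st; apply: points_cross; [exact: (ZP _ (enum_valP s)).1 | exact: (ZP _ (enum_valP t)).1 |].
  by rewrite (inj_eq enum_val_inj).
- by move=> s; have [] := hv s.
- by move=> s; have [] := hv s.
by move=> s; have [] := hv s.
Qed.

Lemma zerosM f g : zeros (f * g) = zeros f :|: zeros g.
Proof. by apply/setP => v; rewrite !inE mevalM mulf_eq0; case: (v != 0); case: (_ == v). Qed.

Lemma homog_gt0 d f : f != 0 -> f \is d.-homog -> ~ divides f 1 -> (0 < d)%N.
Proof. by case: d => // f0 fd []; apply: homog0_unit. Qed.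

(** A proper splitting in degrees [d1] and [d2] gives at most [(d1 + d2 - 2) q + 2], already below
    the claim; only irreducible forms need the geometric argument. *)
Theorem sziklai_bound d f : f != 0 -> f \is d.-homog -> no_line f -> (0 < d)%N -> (d < q)%N ->
  (#|zeros f| <= (d - 1) * q + 1)%N.
Proof.
elim/ltn_ind: d f => d IH f f0 fd nl d0 dq.
have d1 : (1 < d)%N.
  by rewrite ltn_neqAle d0 andbT; apply/eqP => e; rewrite -e in fd; case: (no_line_deg1 f0 fd).
case: (classic (irred_elt f)) => [fI|nI]; first exact: irred_bound.
have fu : ~ divides f 1 by move=> /unit_homog f0'; move: d0; rewrite (dhomog_uniq f0 fd f0').
have [a [b [fab au bu]]] : exists a b : {mpoly F[3]}, [/\ f = a * b, ~ divides a 1 & ~ divides b 1].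
  apply: NNPP => h; apply: nI; split=> // a b fab; apply: NNPP => /not_or_and[na nb].
  by apply: h; exists a, b.
rewrite fab in f0 fd nl *.
have [d1' d1d [ha hb]] := homog_factorl f0 fd.
have [a0 b0] : a != 0 /\ b != 0 by apply/andP; rewrite -negb_or -mulf_eq0.
have ga := homog_gt0 a0 ha au; have gb := homog_gt0 b0 hb bu.
have la := IH d1' _ a a0 ha (no_line_factorl nl) ga _.
have lb := IH (d - d1')%N _ b b0 hb (no_line_factorr nl) gb _.
rewrite zerosM; apply: leq_trans (leq_card_setU _ _) _.
apply: leq_trans (leq_add (la _ _) (lb _ _)) _; try lia.
rewrite -(subnKC d1d) addKn; move: (d - d1')%N gb => d2 gb.
have q0 : (0 < q)%N by apply: leq_trans dq.
move: q q0 => Q Q0; case: d1' ga {ha hb la lb d1d} => // m _; case: d2 gb => // n _.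
by rewrite !subn1 /=; nia.
Qed.

End Sziklai2.

(** * Degree [q] *)

Section DegreeQ.
Variable F : finFieldType.
Implicit Types (a b c l u v w P Q R : vec3 F) (x y t : F) (f g h : {mpoly F[3]}).
Local Notation q := #|F|.

Lemma card_field_eq0 : q%:R = 0 :> F.
Proof.
have : \sum_(x : F) (x + 1) = \sum_(x : F) x.
  by rewrite [RHS](reindex_inj (addIr 1)).
rewrite big_split /= => /(canRL (addKr _)); rewrite addNr => <-.
by rewrite sumr_const.
Qed.

(** For positive [m], some nonzero [y] has [y^m] different from 1, as [X^m - 1] has fewer than
    [q - 1] roots; scaling by [y] permutes the terms yet multiplies the sum by [y^m]. *)
Lemma power_sum_eq0 m : (m < q.-1)%N -> \sum_(x : F) x ^+ m = 0.
Proof.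
case: (posnP m) => [-> _|m0 mq].
  by under eq_bigr => x _ do rewrite expr0; rewrite sumr_const card_field_eq0.
have [y y0 ym] : exists2 y : F, y != 0 & y ^+ m != 1.
  apply/exists_inP; apply: contraTT mq; rewrite negb_exists_in => /forall_inP h.
  have p0 : 'X^m - 1 != 0 :> {poly F} by rewrite -size_poly_gt0 size_XnsubC.
  have := @max_poly_roots F _ (enum [set~ (0 : F)]) p0.
  rewrite size_XnsubC // enum_uniq -cardE cardsC1 -leqNgt ltnS; apply=> //.
  apply/allP => y; rewrite mem_enum !inE => /h; rewrite negbK => /eqP ym.
  by rewrite rootE !hornerE ym subrr.
have : \sum_(x : F) x ^+ m = y ^+ m * \sum_(x : F) x ^+ m.
  rewrite {1}(reindex_inj (mulfI y0)) mulr_sumr; apply: eq_bigr => x _; exact: exprMn.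
move/eqP; rewrite -subr_eq0 -{1}[\sum_(_ : _) _]mul1r -mulrBl mulf_eq0 subr_eq0 eq_sym (negPf ym).
by move/eqP.
Qed.

(** The Chevalley-Warning argument: in each monomial some variable has exponent below [q - 1], and
    its power sum is a factor of the sum. *)
Lemma affine_sum_eq0 d f : f \is d.-homog -> (d < 3 * q.-1)%N -> \sum_(v : vec3 F) f.@[v] = 0.
Proof.
move=> fd dq; under eq_bigr => v _ do rewrite mevalE.
rewrite exchange_big big_seq big1 // => m /(homog_mdeg fd) md; rewrite -mulr_sumr.
suff -> : \sum_(v : vec3 F) \prod_i v i ^+ m i = 0 by rewrite mulr0.
rewrite -(bigA_distr_bigA (fun i x => x ^+ m i)) /=.
have [i mi] : exists i, (m i < q.-1)%N.
  apply/existsP; apply: contraTT dq; rewrite negb_exists => /forallP h.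
  rewrite -leqNgt -md mdegE (_ : (3 * q.-1 = \sum_(i < 3) q.-1)%N); last by rewrite sum_nat_const card_ord.
  apply: leq_sum => i _.
  by rewrite leqNgt.
by rewrite (bigD1 i) //= power_sum_eq0 ?mul0r.
Qed.

Lemma card_proj_class R : R != 0 -> #|proj_class R| = q.-1.
Proof.
move=> R0; rewrite -(cardsC1 (0 : F)) -[RHS](@card_in_imset _ _ (fun x => scale x R)) => [|x y _ _].
  by congr #|pred_of_set _|; apply/setP => v; apply/imsetP/imsetP => -[x]; rewrite !inE => x0 ->; exists x; rewrite ?inE.
exact: scale_inj.
Qed.

Definition covered R n (X : {set vec3 F}) := exists s : seq (vec3 F),
  [/\ (size s <= n)%N, forall a, a \in s -> dot a R != 0
    & forall Q, Q \in X -> exists2 a, a \in s & dot a Q = 0].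

(* If [n = q - 2] lines covered [U :\ R] but not [R], the product of [f] with their equations would
   have degree [2 (q - 1)], hence affine sum [0], while being nonzero only on the class of [R]. *)
Lemma not_covered f R : f \is q.-homog -> R \in points F -> f.@[R] != 0 ->
  ~ covered R (q - 2) [set Q in points F | (f.@[Q] != 0) && (Q != R)].
Proof.
move=> fq Rp fR [s [sn sR scov]]; have q1 := finNzRing_gt1 F.
have [l lR] := dot_neq0 (points_neq0 Rp); rewrite dotC in lR.
(* The power of [l] pads the degree to exactly [q - 2]. The degree of [f * g] is then [2 (q - 1)],
   so [f * g] is constant on the class of [R], and its sum there is [q - 1 = -1] times a nonzero
   value. *)
pose g := \prod_(a <- s) lform a * lform l ^+ (q - 2 - size s).
have gq : g \is (q - 2).-homog.
  have -> : (q - 2 = size s + (q - 2 - size s))%N by rewrite subnKC.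
  apply: dhomogM; last by rewrite -[X in X.-homog]mul1n; apply/dhomogMn/lform_homog.
  elim: (s) => [|a s' IH]; first by rewrite big_nil dhomog1.
  by rewrite big_cons /= -[(size s').+1]add1n; apply: dhomogM => //; apply: lform_homog.
have gv v : g.@[v] = \prod_(a <- s) dot a v * dot l v ^+ (q - 2 - size s).
  rewrite /g mevalM rmorph_prod rmorphXn /= meval_lform; congr (_ * _).
  by apply: eq_bigr => a _; rewrite meval_lform.
have gR : g.@[R] != 0.
  rewrite gv lR expr1n mulr1 prodf_seq_neq0; apply/allP => a /sR.
  by rewrite implyTb.
have hd : f * g \is (q + (q - 2)).-homog by apply: dhomogM.
have := affine_sum_eq0 hd; rewrite (bigID (mem (proj_class R))) /= [X in _ + X]big1 ?addr0; last first.
  move=> v vR; apply/eqP; rewrite mevalM; have [->|v0] := eqVneq v 0.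
    by rewrite -(scale0 v) (meval_scale _ _ fq) expr0n (gtn_eqF (ltnW q1)) mul0r mul0r.
  have [x x0 e] := repE v; apply: contraNT vR => fg0.
  have E : v = scale x^-1 (rep v) by rewrite e scaleA mulVf // scale1.
  move: fg0; rewrite E (meval_scale _ _ fq) (meval_scale _ _ gq) !mulf_eq0 !negb_or.
  case/andP => /andP[_ fv] /andP[_ gv0]; have [<-|ne] := eqVneq (rep v) R.
    by apply/proj_classP; exists x^-1; rewrite ?invr_eq0.
  have [|a as_ a0] := scov (rep v); first by rewrite inE rep_point // fv.
  move: gv0; rewrite gv mulf_eq0 negb_or prodf_seq_neq0 => /andP[/allP/(_ a as_)].
  by rewrite implyTb a0 eqxx.
rewrite (eq_bigr (fun=> (f * g).@[R])) => [|v /proj_classP[x x0 ->]]; last first.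
  rewrite (meval_scale _ _ hd) (_ : (q + (q - 2) = q.-1 + q.-1)%N); last first.
    by move: q1; case: q => [//|[//|n]] _ /=; lia.
  by rewrite exprD -subn1 expfB ?expf_card // expr1 divff // !mul1r.
rewrite sumr_const (card_proj_class (points_neq0 Rp)) => /(_ _)/eqP h.
have {h} := h ltac:(by move: q1; case: q => [//|[//|n]] _ /=; lia).
rewrite -mulr_natr mulf_eq0 mevalM mulf_eq0 (negPf fR) (negPf gR) /= -subn1 natrB ?(ltnW q1) //.
by rewrite card_field_eq0 sub0r oppr_eq0 oner_eq0.
Qed.

Lemma cover_point R Q : R \in points F -> Q \in points F -> Q != R ->
  exists a, dot a R != 0 /\ dot a Q = 0.
Proof.
move=> Rp Qp QR; have [a [aQ aR]] := dot_cross_neq0 (points_cross Qp Rp QR).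
by exists a; rewrite aR oner_eq0.
Qed.

Definition join R Q : vec3 F := rep (cross R Q).

Lemma det_cyclic a b c : dot (cross a b) c = dot (cross b c) a.
Proof. by rewrite /dot !sum3 !crossE; ring. Qed.

(** The line through [Q] and [Q'] contains [R] only if both points lie on one line through [R]. *)
Lemma cover_pair R Q Q' : R \in points F -> Q \in points F -> Q' \in points F -> Q != R -> Q' != R ->
  join R Q != join R Q' -> exists a, [/\ dot a R != 0, dot a Q = 0 & dot a Q' = 0].
Proof.
move=> Rp Qp Qp' QR QR' ne; exists (cross Q Q'); split; last 2 first.
- by rewrite dotC dot_crossl.
- by rewrite dotC dot_crossr.
apply: contraNneq ne => det0; have RQ' : cross R Q' != 0 by rewrite points_cross // eq_sym.
have RQ : cross R Q != 0 by rewrite points_cross // eq_sym.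
have [|| x e] := @dot_kernel_cross F (cross R Q) R Q' RQ'.
- by rewrite dotC dot_crossl.
- by rewrite det_cyclic.
apply/eqP; rewrite /join e rep_scale //.
by apply: contraNneq RQ => x0; rewrite e x0 scale0.
Qed.

Lemma mem_join R Q : R \in points F -> Q \in points F -> Q != R ->
  [/\ join R Q \in points F, dot (join R Q) R = 0 & dot (join R Q) Q = 0].
Proof.
move=> Rp Qp QR; have RQ : cross R Q != 0 by rewrite points_cross // eq_sym.
have [x x0 e] := repE (cross R Q); split; first exact: rep_point.
  by rewrite /join e dot_scalel dotC dot_crossl mulr0.
by rewrite /join e dot_scalel dotC dot_crossr mulr0.
Qed.

Lemma sorted_by_key (T : finType) (K : T -> nat) (X : {set T}) :
  exists s : seq T, [/\ uniq s, s =i X & forall (z : T) i j, (i <= j)%N -> (j < size s)%N ->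
    (K (nth z s i) <= K (nth z s j))%N].
Proof.
pose le (y z : T) := (K y <= K z)%N; have let_ : transitive le by move=> y x z; apply: leq_trans.
exists (sort le (enum X)); split.
- by rewrite sort_uniq enum_uniq.
- by move=> x; rewrite mem_sort mem_enum.
move=> z i j ij js; have srt : sorted le (sort le (enum X)).
  by apply: sort_sorted => x y; apply: leq_total.
apply: (sorted_leq_nth let_ _ z srt) => //; first by move=> x; apply: leqnn.
by rewrite inE; apply: leq_ltn_trans ij js.
Qed.

(* Sort [X] by the line through [R]: positions [i] and [i + n] never carry the same line. *)
Lemma pairing_cover R n (X : {set vec3 F}) : R \in points F -> X \subset points F -> R \notin X ->
  (#|X| <= 2 * n)%N -> (forall a, (#|[set Q in X | join R Q == a]| <= n)%N) -> covered R n X.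
Proof.
move=> Rp /subsetP Xp RX Xn cls; have [s [us sX ks]] := sorted_by_key (fun Q => enum_rank (join R Q) : nat) X.
have szs : size s = #|X| by rewrite -(card_uniqP us); apply: eq_card.
have nX i : (i < size s)%N -> nth 0 s i \in points F /\ nth 0 s i != R.
  move=> is_; have /[dup] h : nth 0 s i \in X by rewrite -sX mem_nth.
  by move=> /Xp ->; split=> //; apply: contraNneq RX => <-.
have [l lR] := dot_neq0 (points_neq0 Rp); rewrite dotC in lR.
(* Equal keys at [i] and [i + n] would force, by sorting, [n + 1] positions with one key, one more
   than a class may hold. *)
have ne i : (i + n < size s)%N -> join R (nth 0 s i) != join R (nth 0 s (i + n)).
  move=> ins; apply/eqP => e; have := cls (join R (nth 0 s i)); rewrite leqNgt => /negP[].
  pose phi (j : 'I_n.+1) := nth 0 s (i + j).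
  have is_ (j : 'I_n.+1) : (i + j < size s)%N.
    by apply: leq_ltn_trans ins; rewrite leq_add2l -ltnS.
  have phi_inj : injective phi.
    move=> j k /eqP; rewrite /phi nth_uniq ?is_ // eqn_add2l => /eqP; exact: val_inj.
  have := card_codom phi_inj; rewrite card_ord => <-; apply: subset_leq_card; apply/subsetP => Q /codomP[j ->].
  rewrite inE -sX mem_nth ?is_ //=; apply/eqP/enum_rank_inj/val_inj/eqP; rewrite eqn_leq.
  apply/andP; split; last by apply: (ks 0 i (i + j)%N) => //; apply: leq_addr.
  by rewrite e; apply: (ks 0 (i + j)%N (i + n)%N) => //; rewrite leq_add2l -ltnS.
have cov (i : 'I_n) : exists a, [/\ dot a R != 0, (i < size s)%N -> dot a (nth 0 s i) = 0 &
    (i + n < size s)%N -> dot a (nth 0 s (i + n)) = 0].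
  have [ins|ins] := ltnP (i + n) (size s).
    have is_ : (i < size s)%N by apply: leq_ltn_trans ins; apply: leq_addr.
    have [[p1 r1] [p2 r2]] := (nX _ is_, nX _ ins).
    by have [a [? ? ?]] := cover_pair Rp p1 p2 r1 r2 (ne _ ins); exists a.
  have [is_|is_] := ltnP i (size s); last by exists l; rewrite lR oner_eq0.
  by have [p1 r1] := nX _ is_; have [a [? ?]] := cover_point Rp p1 r1; exists a.
have [A hA] := fin_all_exists cov; exists (codom A); split.
- by rewrite size_codom card_ord.
- by move=> a /codomP[i ->]; have [] := hA i.
move=> Q; rewrite -sX => Qs; have Qi : (index Q s < size s)%N by rewrite index_mem.
have [iN|iN] := ltnP (index Q s) n.
  exists (A (Ordinal iN)); first exact: codom_f.
  by have [_ /(_ Qi)] := hA (Ordinal iN); rewrite /= nth_index.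
have jN : (index Q s - n < n)%N by rewrite ltn_subLR // addnn -mul2n (leq_trans Qi) // szs.
exists (A (Ordinal jN)); first exact: codom_f.
by have [_ _] := hA (Ordinal jN); rewrite /= subnK // nth_index // => /(_ Qi).
Qed.

Lemma covered_cons R n b (X : {set vec3 F}) : dot b R != 0 ->
  covered R n [set Q in X | dot b Q != 0] -> covered R n.+1 X.
Proof.
move=> bR [s [sn sR sX]]; exists (b :: s); split=> //.
  by move=> a; rewrite inE => /orP[/eqP ->|/sR].
move=> Q QX; have [b0|b0] := eqVneq (dot b Q) 0; first by exists b; rewrite ?mem_head.
have [|a as_ a0] := sX Q; first by rewrite inE QX.
by exists a => //; rewrite inE as_ orbT.
Qed.

Lemma nonroot_exists (p : {poly F}) : p != 0 -> (size p <= q)%N -> exists t, p.[t] != 0.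
Proof.
move=> p0 sp; apply/existsP; apply: contraTT sp; rewrite negb_exists => /forallP h.
rewrite -ltnNge; apply: leq_trans (card_roots_lt p0); rewrite ltnS -cardsT subset_leq_card //.
by apply/subsetP => t _; rewrite inE -[_ == _]negbK h.
Qed.

Lemma nonroot_exists_double (p : {poly F}) : p != 0 -> (size p <= q.+1)%N -> p`_0 = 0 -> p`_1 = 0 ->
  exists t, p.[t] != 0.
Proof.
move=> p0 sp p00 p01; pose r := drop_poly 2 p.
have pr : p = r * 'X^2.
  rewrite -[LHS](poly_take_drop 2) (_ : take_poly 2 p = 0) ?add0r //.
  by apply/polyP => -[|[|i]]; rewrite coef_take_poly coef0.
have r0 : r != 0 by apply: contraNneq p0 => r0; rewrite pr r0 mul0r.
have [||t rt] := @nonroot_exists (r * 'X).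
- by rewrite mulf_neq0 // polyX_eq0.
- by move: sp; rewrite pr size_mulXn // size_mulX.
exists t; move: rt; rewrite pr !hornerE !mulf_eq0 !negb_or => /andP[-> t0].
by rewrite t0.
Qed.

Lemma off_line_arith (n m k Q : nat) : (n < 2 * Q - 1)%N -> (5 <= Q)%N -> (3 <= m)%N ->
  n = (m + k.+1)%N -> (k <= 2 * (Q - 3))%N.
Proof. lia. Qed.

Lemma large_class_arith (n m k ma c Q : nat) : (n < 2 * Q - 1)%N -> n = (m + k.+1)%N ->
  (Q - 3 < c)%N -> (c <= ma.-1)%N -> (ma <= m)%N -> (c <= k)%N -> [/\ (k <= c)%N, (ma < Q)%N & (m < Q)%N].
Proof. by move=> *; split; lia. Qed.

(** * Rational points off a curve of degree [q] without rational lines *)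

Section NoLine.
Variable f : {mpoly F[3]}.
Hypotheses (fq : f \is q.-homog) (nl : no_line f).
Let U := [set Q in points F | f.@[Q] != 0].

Let in_U Q : Q != 0 -> f.@[Q] != 0 -> rep Q \in U.
Proof.
move=> Q0 fQ; have [x x0 e] := repE Q.
by rewrite inE rep_point // e (meval_scale _ _ fq) mulf_neq0 // expf_neq0.
Qed.

Let U_points Q : Q \in U -> Q \in points F.
Proof. by rewrite inE => /andP[]. Qed.

Let dot_rep a Q : (dot a (rep Q) == 0) = (dot a Q == 0).
Proof. by have [x x0 ->] := repE Q; rewrite dot_scaler mulf_eq0 (negPf x0). Qed.

(** [U] is a blocking set: if the point [v] at infinity of the line is a zero of [f], the
    restriction has degree below [q] and cannot vanish on all of [F]. *)
Let blocking a : a != 0 -> exists2 Q, Q \in U & dot a Q = 0.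
Proof.
move=> a0; have : (1 < #|line a|)%N by rewrite card_line // ltnS (ltnW (finNzRing_gt1 F)).
case/card_gt1P => P [v []]; rewrite !inE -!/(_ \in points F).
case/andP => Pp /eqP aP /andP[vp /eqP av] Pv.
have Ppt : P \in points F by rewrite inE. have vpt : v \in points F by rewrite inE.
have Pv0 := points_cross Ppt vpt Pv; have p0 := no_line_neq0 nl fq Pv0.
have [fv|fv] := eqVneq f.@[v] 0; last first.
  by exists v => //; rewrite inE vpt.
have [|t pt] := nonroot_exists p0.
  apply/leq_sizeP => j; rewrite leq_eqVlt => /orP[/eqP <-|lt]; first by rewrite (on_line_coef_deg _ _ fq).
  by rewrite nth_default // (leq_trans (size_on_line _ _ fq)).
rewrite -horner_on_line_scale in pt.
have aPt : dot a (P + scale t v) = 0 by rewrite dotDr aP dot_scaler av mulr0 addr0.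
exists (rep (P + scale t v)); last by apply/eqP; rewrite dot_rep aPt.
apply: in_U => //; apply: contraNneq Pv0 => e.
have -> : P = scale (- t) v by rewrite -[LHS](addrK (scale t v)) e add0r; apply/ffunP => i; rewrite !ffunE mulNr.
by rewrite cross_eq0C cross_scale.
Qed.

(* The tangent at a zero [P] off the line [b], parametrised from its point on [b]. *)
Let off_line b : b != 0 -> exists2 R, R \in U & dot b R != 0.
Proof.
move=> b0; have [c bc] := dot_neq0 b0.
have c0 : c != 0 by apply: contraTneq isT => c0; move/eqP: bc; rewrite c0 -(scale0 b) dot_scaler mul0r eq_sym oner_eq0.
have bc0 : dot b (rep c) != 0 by rewrite dot_rep bc oner_eq0.
have Pp := rep_point c0; move: (rep c) bc0 Pp => P bP Pp.
have [fP|fP] := eqVneq f.@[P] 0; last by exists P => //; rewrite inE Pp.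
have [v Pv v1] := tangent_direction (points_neq0 Pp) fq fP.
have [g hg] := gradient_exists P f; pose v' := scale (dot b P) v + scale (- dot b v) P.
have bv' : dot b v' = 0 by rewrite dotDr !dot_scaler; ring.
have Pv' : cross P v' != 0.
  have -> : cross P v' = scale (dot b P) (cross P v).
    by apply: vec3P; rewrite !ffunE /= ?ffunE; ring.
  by rewrite scale_eq0 negb_or bP.
have v'1 : (on_line P v' f)`_1 = 0.
  rewrite hg dotDr !dot_scaler -!hg v1 (on_line_self fq fP) coef0; ring.
have [|t pt] := nonroot_exists_double (no_line_neq0 nl fq Pv') (size_on_line _ _ fq) _ v'1.
  by rewrite on_line_coef0.
rewrite -horner_on_line_scale in pt.
have bPt : dot b (P + scale t v') != 0 by rewrite dotDr dot_scaler bv' mulr0 addr0.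
exists (rep (P + scale t v')); last by rewrite dot_rep.
apply: in_U => //; apply: contraNneq bPt => ->; rewrite /dot big1 // => i _.
by rewrite ffunE mulr0.
Qed.

Let mu a := #|[set Q in U | dot a Q == 0]|.

Let common_points a b P Q v : a != 0 -> P \in points F -> Q \in points F -> P != Q ->
  dot a P = 0 -> dot a Q = 0 -> dot b P = 0 -> dot b Q = 0 -> dot a v = 0 -> dot b v = 0.
Proof.
move=> a0 Pp Qp PQ aP aQ bP bQ; have PQ0 := points_cross Pp Qp PQ.
have [x ea] := dot_kernel_cross PQ0 aP aQ; have [y ->] := dot_kernel_cross PQ0 bP bQ.
move: a0; rewrite ea scale_eq0 negb_or dot_scalel dot_scalel => /andP[x0 _] /eqP.
by rewrite mulf_eq0 (negPf x0) => /eqP ->; rewrite mulr0.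
Qed.

Let card_common a b R : a != 0 -> dot a R = 0 -> dot b R != 0 ->
  (#|[set Q in line b | dot a Q == 0%R]| <= 1)%N.
Proof.
move=> a0 aR bR; rewrite leqNgt; apply/negP => /card_gt1P[P [Q []]].
rewrite !inE -!/(_ \in points F) => /andP[/andP[Pp /eqP bP] /eqP aP] /andP[/andP[Qp /eqP bQ] /eqP aQ] PQ.
have Ppt : P \in points F by rewrite inE. have Qpt : Q \in points F by rewrite inE.
by move/eqP: bR; apply; apply: (common_points a0 Ppt Qpt PQ).
Qed.

(** Of the [q + 1] points of [b], at most [q - 1] lie in [U] and at most one lies on [a]. *)
Let missing_point a b R : a != 0 -> b != 0 -> dot a R = 0 -> dot b R != 0 -> (mu b < q)%N ->
  exists x : vec3 F, [/\ x \in points F, dot b x = 0, dot a x != 0 & x \notin U].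
Proof.
move=> a0 b0 aR bR mub; apply: NNPP => h.
have : line b \subset [set Q in U | dot b Q == 0] :|: [set Q in line b | dot a Q == 0].
  apply/subsetP => x xb; apply/negPn/negP => nx; apply: h; exists x.
  move: xb nx; rewrite !inE => /andP[-> /eqP ->]; rewrite eqxx !andbT /=.
  by rewrite negb_or => /andP[-> ->].
move/subset_leq_card; rewrite card_line //; apply/negP; rewrite -ltnNge.
apply: leq_ltn_trans (leq_card_setU _ _) _; have := card_common a0 aR bR; rewrite -/(mu b).
by move: mub; lia.
Qed.

(** Take [x] on [b] only and [y] on [a] only, both outside [U]. The line joining them meets [a] and
    [b] nowhere else, so it would miss [U], against [blocking]. *)
Let not_two_lines a b R : a != 0 -> b != 0 -> dot a R = 0 -> dot b R != 0 ->
  (mu a < q)%N -> (mu b < q)%N ->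
  ~ (forall Q, Q \in U -> dot a Q = 0 \/ dot b Q = 0).
Proof.
move=> a0 b0 aR bR mua mub h.
have [x [xp bx ax xU]] := missing_point a0 b0 aR bR mub.
have [y [yp ay by_ yU]] := missing_point b0 a0 bx ax mua.
have xy : x != y by apply: contraNneq ax => ->; rewrite ay.
have c0 := points_cross xp yp xy; have [Q QU cQ] := blocking c0.
have cx : dot (cross x y) x = 0 by rewrite dotC dot_crossl.
have cy : dot (cross x y) y = 0 by rewrite dotC dot_crossr.
have Qp := U_points QU; have Qx : Q != x by apply: contraNneq xU => <-.
have Qy : Q != y by apply: contraNneq yU => <-.
case: (h Q QU) => [aQ|bQ].
  by move/eqP: ax; apply; apply: (common_points c0 Qp yp Qy).
by move/eqP: by_; apply; apply: (common_points c0 Qp xp Qx).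
Qed.

Let nc R : R \in U -> ~ covered R (q - 2) (U :\ R).
Proof.
rewrite inE => /andP[Rp fR]; have := not_covered fq Rp fR.
by rewrite (_ : U :\ R = [set Q in points F | (f.@[Q] != 0) && (Q != R)]) //;
  apply/setP => Q; rewrite !inE; case: (Q == R); rewrite ?andbF ?andbT.
Qed.

Let class_sub R a (X : {set vec3 F}) : R \in U -> X \subset U :\ R ->
  [set Q in X | join R Q == a] \subset [set Q in U | dot a Q == 0] :\ R.
Proof.
move=> RU /subsetP XU; apply/subsetP => Q /setIdP[QX /eqP ea].
have /setD1P[QR QU] := XU _ QX; have [_ _] := mem_join (U_points RU) (U_points QU) QR.
by rewrite ea => aQ; apply/setD1P; split=> //; apply/setIdP; rewrite aQ.
Qed.

Let class_card R a (X : {set vec3 F}) : R \in U -> X \subset U :\ R ->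
  (#|[set Q in X | join R Q == a]| <= (mu a).-1)%N.
Proof.
move=> RU XU; have [-> |[P /setIdP[PX /eqP ea]]] := set_0Vmem [set Q in X | join R Q == a].
  by rewrite cards0.
have /setD1P[PR PU] := subsetP XU _ PX; have [_ aR _] := mem_join (U_points RU) (U_points PU) PR.
have := subset_leq_card (class_sub a RU XU).
have := cardsD1 R [set Q in U | dot a Q == 0]; rewrite -/(mu a) => ->.
have -> : R \in [set Q in U | dot a Q == 0] by apply/setIdP; rewrite -ea aR.
by [].
Qed.

Hypothesis q5 : (5 <= q)%N.

(** Let [b] be a line with the most points of [U]. If it has at least 3, take [R] off [b]: one line
    covers the points on [b], and at most [2 (q - 3)] points remain to be paired by [q - 3] lines.
    Pairing fails only if one line through [R] is too rich, and then [U] lies on two lines. If [b]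
    has at most 2 points, all lines through [R] are poor. *)
Lemma card_nonzeros : (2 * q - 1 <= #|U|)%N.
Proof.
rewrite leqNgt; apply/negP => Uq.
have [a0 a0p] : exists a, a \in points F.
  by apply/card_gt0P; rewrite card_points addn1.
case: (arg_maxnP mu a0p) => b bp maxb; have b0 := points_neq0 bp.
have UP (X : {set vec3 F}) : X \subset U -> X \subset points F by move=> h; apply: (subset_trans h); apply/subsetP => Q; apply: U_points.
have mumax a : (mu a <= mu b)%N \/ a = 0.
  have [->|a_0] := eqVneq a 0; [by right | left].
  rewrite (_ : mu a = mu (rep a)); first exact/maxb/rep_point.
  by apply: eq_card => Q; rewrite !inE [dot (rep a) Q]dotC dotC; have [x x0 ->] := repE a; rewrite dot_scaler mulf_eq0 (negPf x0).
have [mub|mub] := leqP 3 (mu b).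
  have [R RU bR] := off_line b0; apply: (nc RU).
  have -> : (q - 2 = (q - 3).+1)%N by lia.
  apply: (covered_cons bR); set X := [set _ in _ | _].
  have XUR : X \subset U :\ R by apply/subsetP => Q; rewrite inE => /andP[].
  have XU : X \subset U := subset_trans XUR (subsetDl _ _).
  have RX : R \notin X by rewrite !inE eqxx.
  have cX : (#|U| = mu b + #|X|.+1)%N.
    have -> : #|X|.+1 = #|[set Q in U | dot b Q != 0]|.
      rewrite (cardsD1 R [set Q in U | dot b Q != 0]).
      have -> : R \in [set Q in U | dot b Q != 0] by apply/setIdP.
      congr _.+1; apply: eq_card => Q; apply/setIdP/setD1P => [[/setD1P[? ?] ?]|[? /setIdP[? ?]]].
        by split=> //; apply/setIdP.
      by split=> //; apply/setD1P.
    rewrite /mu -(cardsID [set Q : vec3 F | dot b Q == 0] U).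
    by congr (_ + _)%N; apply: eq_card => Q; rewrite !inE // andbC.
  have [|[a ha]] : (forall a, (#|[set Q in X | join R Q == a]| <= q - 3)%N) \/
      exists a, (q - 3 < #|[set Q in X | join R Q == a]|)%N.
    case: (classic (exists a, (q - 3 < #|[set Q in X | join R Q == a]|)%N)) => h; [by right | left].
    by move=> a; rewrite leqNgt; apply/negP => ?; apply: h; exists a.
    apply: (pairing_cover (U_points RU) (UP _ XU) RX) => //.
    exact: off_line_arith Uq q5 mub cX.
  have cls := class_card a RU XUR.
  have cls2 : (#|[set Q in X | join R Q == a]| <= #|X|)%N.
    by apply: subset_leq_card; apply/subsetP => Q /setIdP[].
  have [mua|a00] := mumax a; last first.
    move: ha; rewrite (_ : [set _ in _ | _] = set0) ?cards0 //; apply/setP => Q; rewrite in_set in_set0.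
    apply/andP => -[QX /eqP ea]; have /setD1P[QR QU] := subsetP XUR _ QX.
    have [ap _ _] := mem_join (U_points RU) (U_points QU) QR.
    by move: (points_neq0 ap); rewrite ea a00 eqxx.
  (* A class of at least [q - 2] points gives [a], hence also [b], at least [q - 1] points of [U];
     with [#|U|] at most [2 q - 2] both numbers equal [q - 1] and all of [X] lies on [a]. *)
  have [kc ma_q mb_q] := large_class_arith Uq cX ha cls mua cls2.
  have Xa : [set Q in X | join R Q == a] = X.
    apply/eqP; rewrite eqEcard; apply/andP; split=> //; by apply/subsetP => Q /setIdP[].
have [P PX] : exists P, P \in X.
    by apply/card_gt0P; apply: leq_trans cls2; apply: leq_ltn_trans ha.
  have jP : join R P = a by move: PX; rewrite -Xa => /setIdP[_ /eqP].
  have /setD1P[PR PU] := subsetP XUR _ PX.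
  have [ap aR aP] := mem_join (U_points RU) (U_points PU) PR; rewrite jP in ap aR aP.
  have a_0 := points_neq0 ap.
  exfalso; apply: (not_two_lines a_0 b0 aR bR ma_q mb_q) => Q QU.
  have [bQ|bQ] := eqVneq (dot b Q) 0; [by right | left].
  have [->//|QR] := eqVneq Q R; have : Q \in X by apply/setIdP; split=> //; apply/setD1P.
  rewrite -Xa => /setIdP[QX /eqP <-].
  by have [_ _] := mem_join (U_points RU) (U_points QU) QR.
have [R RU _] := blocking b0; apply: (nc RU); have Rp := U_points RU.
have cls a : (#|[set Q in U :\ R | join R Q == a]| <= 1)%N.
  have [mua|a00] := mumax a; last first.
    rewrite (_ : [set _ in _ | _] = set0) ?cards0 //; apply/setP => Q; rewrite in_set in_set0.
    apply/andP => -[/setD1P[QR QU] /eqP ea].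
    have [ap _ _] := mem_join Rp (U_points QU) QR.
    by move: (points_neq0 ap); rewrite ea a00 eqxx.
  by apply: leq_trans (class_card a RU (subxx _)) _; lia.
apply: pairing_cover => //; first by apply/UP/subsetDl.
- by rewrite !inE eqxx.
(* Each of the [q + 1] lines through [R] has at most one further point of [U]; [q + 1 <= 2 (q - 2)]
   is where [5 <= q] enters. *)
- suff h : (#|U :\ R| <= q.+1)%N by apply: leq_trans h _; lia.
  rewrite -(card_line (points_neq0 Rp)) -(@card_in_imset _ _ (join R)).
    apply: subset_leq_card; apply/subsetP => a /imsetP[Q /setD1P[QR QU] ->].
    have [jp jR _] := mem_join Rp (U_points QU) QR.
    by apply/setIdP; rewrite dotC jR.
  move=> P Q PU QU e; apply: (card_le1_eqP (cls (join R P))); apply/setIdP; split=> //.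
  by rewrite e.
by move=> a; apply: leq_trans (cls a) _; lia.
Qed.

Theorem degree_q_bound : (#|zeros f| <= (q - 1) * q + 2)%N.
Proof.
have h := card_nonzeros; have := cardsID (zeros f) (points F).
rewrite (_ : points F :&: zeros f = zeros f); last by apply/setIidPr/subsetP => Q /setIdP[].
rewrite (_ : points F :\: zeros f = U) => [|].
  (* Removing [2 q - 1] of the [q^2 + q + 1] points leaves [(q - 1) q + 2]. *)
  rewrite card_points; move: #|zeros f| #|U| h => z n; move: q q5 => Q Q5.
  by rewrite mulnBl mul1n !expnS expn0 muln1; nia.
apply/setP => Q; rewrite in_setD; apply/andP/setIdP => [[nz Qp]|[Qp fQ]]; split=> //.
  by apply: contraNN nz => fz; apply/setIdP.
by apply/negP => /setIdP[_]; apply/negP.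
Qed.

End NoLine.

End DegreeQ.

(** * Line arrangements *)

Section Arrangements.
Variable F : finFieldType.
Implicit Types (a b c e l u v w P Q R : vec3 F) (x y t : F) (f g h : {mpoly F[3]}) (s B : seq (vec3 F)).
Local Notation q := #|F|.

Definition lines_union s : {set vec3 F} := [set Q in points F | has (fun a => dot a Q == 0) s].

Lemma mem_lines_union s Q : (Q \in lines_union s) = (Q \in points F) && has (fun a => dot a Q == 0) s.
Proof. by rewrite in_set. Qed.

Lemma mem_line a Q : (Q \in line a) = (Q \in points F) && (dot a Q == 0).
Proof. by rewrite in_set. Qed.

Lemma lines_union_cons a s : lines_union (a :: s) = line a :|: lines_union s.
Proof. by apply/setP => Q; rewrite in_setU !mem_lines_union mem_line /= -andb_orr. Qed.

Lemma eq_lines_union s s' : s =i s' -> lines_union s = lines_union s'.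
Proof. by move=> h; apply/setP => Q; rewrite !mem_lines_union (eq_has_r h). Qed.

Lemma lines_union_rep s : lines_union (map (@rep F) s) = lines_union s.
Proof.
apply/setP => Q; rewrite !mem_lines_union has_map; congr (_ && _); apply: eq_has => a /=.
by have [x x0 ->] := repE a; rewrite dot_scalel mulf_eq0 (negPf x0).
Qed.

Lemma zeros_lform a : zeros (lform a) = line a.
Proof. by apply/setP => Q; rewrite mem_line in_set meval_lform. Qed.

Lemma zeros_const f : f != 0 -> f \is 0.-homog -> zeros f = set0.
Proof.
move=> f0 /(homog0_unit f0)[c e]; apply/setP => Q; rewrite in_set in_set0.
apply/negP => /andP[_ /eqP fQ]; have := congr1 (meval Q) e.
by rewrite meval1 mevalM fQ mulr0 => /eqP; rewrite oner_eq0.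
Qed.

Lemma zeros_prod_lines s : zeros (\prod_(a <- s) lform a) = lines_union s.
Proof.
elim: s => [|a s IH]; first by rewrite big_nil zeros_const ?oner_eq0 ?dhomog1 //; apply/setP => Q; rewrite mem_lines_union andbF in_set0.
by rewrite big_cons zerosM IH zeros_lform lines_union_cons.
Qed.

Lemma prod_lines_homog s : \prod_(a <- s) lform a \is (size s).-homog.
Proof.
elim: s => [|a s IH]; first by rewrite big_nil dhomog1.
by rewrite big_cons /= -[(size s).+1]add1n; apply: dhomogM => //; apply: lform_homog.
Qed.

Lemma lines_meet a b : a != 0 -> exists Q, [/\ Q \in points F, dot a Q = 0 & dot b Q = 0].
Proof.
move=> a0; have [/(cross_eq0 a0)[x ->]|ab] := eqVneq (cross a b) 0; last first.
  have [x x0 ex] := repE (cross a b); exists (rep (cross a b)); rewrite rep_point //.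
  by rewrite ex !dot_scaler dot_crossl dot_crossr mulr0.
have : (0 < #|line a|)%N by rewrite card_line.
by case/card_gt0P => Q /setIdP[Qp /eqP aQ]; exists Q; rewrite dot_scalel aQ mulr0.
Qed.

Lemma card_line_setD a (A : {set vec3 F}) k : a != 0 -> (k <= #|line a :&: A|)%N -> (#|line a :\: A| <= q.+1 - k)%N.
Proof. by move=> a0; rewrite cardsD card_line // => h; apply: leq_sub2l. Qed.

Lemma card_lines_union_cat B s k : (forall e, e \in s -> (#|line e :\: lines_union B| <= k)%N) ->
  (#|lines_union (B ++ s)| <= #|lines_union B| + size s * k)%N.
Proof.
elim: s => [|e s IH] h; first by rewrite cats0 addn0.
have -> : lines_union (B ++ e :: s) = lines_union (B ++ s) :|: (line e :\: lines_union B).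
  apply/setP => Q; rewrite in_setU in_setD !mem_lines_union mem_line !has_cat /=.
  by case: (Q \in points F); case: has; case: (_ == 0); case: has.
apply: leq_trans (leq_card_setU _ _) _; rewrite /= mulSn addnCA addnC leq_add //.
  by apply: h; rewrite mem_head.
by apply: IH => e' e's; apply: h; rewrite inE e's orbT.
Qed.

Lemma lines_union1 a : lines_union [:: a] = line a.
Proof.
rewrite lines_union_cons (_ : lines_union [::] = set0) ?setU0 //; apply/setP => Q.
by rewrite mem_lines_union andbF in_set0.
Qed.

Lemma card_lines_union s : (0 < size s)%N -> all (fun a => a != 0) s -> (#|lines_union s| <= size s * q + 1)%N.
Proof.
case: s => // a s _ /= /andP[a0 /allP s0]; rewrite -cat1s.
apply: leq_trans (@card_lines_union_cat [:: a] s q _) _; last by rewrite lines_union1 card_line // mulSn addn1 addSn.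
move=> e /s0 e0; rewrite -[X in (_ <= X)%N](subn1 q.+1); apply: card_line_setD => //.
rewrite lines_union1; have [Q [Qp eQ aQ]] := lines_meet a e0.
by apply/card_gt0P; exists Q; rewrite in_setI !mem_line Qp eQ aQ eqxx.
Qed.

Lemma card_meets B e : {subset B <= points F} -> uniq B -> e \in points F -> e \notin B ->
  (forall a a' Q, a \in B -> a' \in B -> a != a' -> Q \in points F ->
     dot a Q = 0 -> dot a' Q = 0 -> dot e Q != 0) ->
  (size B <= #|line e :&: lines_union B|)%N.
Proof.
move=> Bp uB ep eB conc; rewrite cardE -(size_map (fun a => rep (cross a e))).
have ae a : a \in B -> cross a e != 0.
  by move=> aB; apply: points_cross => //; [exact: Bp | apply: contraNneq eB => <-].
have m a : a \in B -> [/\ rep (cross a e) \in points F, dot a (rep (cross a e)) = 0 & dot e (rep (cross a e)) = 0].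
  move=> /ae h; have [x x0 ex] := repE (cross a e); rewrite rep_point //.
  by rewrite ex !dot_scaler dot_crossl dot_crossr mulr0.
apply: uniq_leq_size.
  rewrite map_inj_in_uniq // => a a' aB aB' eq; have [p1 p2 p3] := m _ aB; have [_ p2' _] := m _ aB'.
  by apply/eqP/negPn/negP => ne; have := conc _ _ _ aB aB' ne p1 p2; rewrite {1}eq p2' p3 eqxx => /(_ erefl).
move=> Q /mapP[a aB ->]; have [p1 p2 p3] := m _ aB.
by rewrite mem_enum in_setI mem_line mem_lines_union p1 p3 eqxx /=; apply/hasP; exists a; rewrite ?p2.
Qed.

Lemma card_meets_leq B e : e != 0 -> (forall a, a \in B -> cross a e != 0) -> (#|line e :&: lines_union B| <= size B)%N.
Proof.
move=> e0; elim: B => [|a B IH] hB.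
  by rewrite (_ : line e :&: _ = set0) ?cards0 //; apply/setP => Q; rewrite in_setI mem_lines_union andbF andbF in_set0.
rewrite lines_union_cons setIUr; apply: leq_trans (leq_card_setU _ _) _; rewrite -[(size _)]/(1 + size B)%N leq_add //; last first.
  by apply: IH => b bB; apply: hB; rewrite inE bB orbT.
have ae := hB a (mem_head _ _).
apply/card_le1_eqP => P Q; rewrite !in_setI !mem_line.
case/andP => /andP[Pp /eqP eP] /andP[_ /eqP aP] /andP[/andP[Qp /eqP eQ] /andP[_ /eqP aQ]].
have [x eP'] : exists x, P = scale x (cross a e) by apply: dot_kernel_cross => //; rewrite dotC.
have [y eQ'] : exists y, Q = scale y (cross a e) by apply: dot_kernel_cross => //; rewrite dotC.
have y0 : y != 0 by apply: contraTneq (points_neq0 Qp) => y0; rewrite eQ' y0 scale0 eqxx.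
suff -> : P = Q by [].
by apply: (points_scale (x := x / y) Pp Qp); rewrite eP' eQ' scaleA divfK.
Qed.

Lemma line_unique a a' P Q : a \in points F -> a' \in points F -> P \in points F -> Q \in points F ->
  P != Q -> dot a P = 0 -> dot a Q = 0 -> dot a' P = 0 -> dot a' Q = 0 -> a = a'.
Proof.
move=> ap ap' Pp Qp PQ aP aQ aP' aQ'; have PQ0 := points_cross Pp Qp PQ.
have [x ea] := dot_kernel_cross PQ0 aP aQ; have [y ea'] := dot_kernel_cross PQ0 aP' aQ'.
have y0 : y != 0 by apply: contraTneq (points_neq0 ap') => y0; rewrite ea' y0 scale0 eqxx.
by apply: (points_scale (x := x / y) ap ap'); rewrite ea ea' scaleA divfK.
Qed.

Lemma union_arith (z A I V Q : nat) : (z <= A)%N -> (I <= 1)%N -> (V + I = A + Q.+1)%N -> (Q + z <= V)%N.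
Proof. lia. Qed.

(** Adjoining [P] lets the induction start from the empty list; each new line then adds exactly its
    points other than [P]. *)
Lemma card_concurrent P s : P \in points F -> uniq s -> {subset s <= points F} ->
  (forall a, a \in s -> dot a P = 0) -> (size s * q + 1 <= #|P |: lines_union s|)%N.
Proof.
move=> Pp; elim: s => [|a s IH] /=; first by move=> *; rewrite mul0n; apply/card_gt0P; exists P; rewrite !inE eqxx.
case/andP => as_ us sp sP; have ap : a \in points F by apply: sp; rewrite mem_head.
have {}IH := IH us (fun b bs => sp b (@mem_behead _ (a :: s) b bs)) (fun b bs => sP b (@mem_behead _ (a :: s) b bs)).
have -> : P |: lines_union (a :: s) = (P |: lines_union s) :|: line a by rewrite lines_union_cons setUCA setUC -setUA; congr (_ :|: _).
have := cardsUI (P |: lines_union s) (line a); rewrite (card_line (points_neq0 ap)) => e.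
suff h : (#|(P |: lines_union s) :&: line a| <= 1)%N by rewrite mulSn -addnA; apply: union_arith IH h e.
rewrite -[X in (_ <= X)%N](cards1 P) subset_leq_card //; apply/subsetP => Q; rewrite in_setI in_setU1 mem_lines_union mem_line inE.
case/andP => /orP[//|/andP[Qp /hasP[b bs /eqP bQ]]] /andP[_ /eqP aQ]; apply: contraNT as_ => QP.
suff -> : a = b by [].
by apply: (@line_unique a b P Q); rewrite 1?eq_sym // ?sP ?mem_head ?sp // inE bs orbT.
Qed.

Lemma concurrent_meets P B e : P \in points F -> {subset B <= points F} -> uniq B -> e \in points F ->
  (forall a, a \in B -> dot a P = 0) -> dot e P != 0 -> (size B <= #|line e :&: lines_union B|)%N.
Proof.
move=> Pp Bp uB ep BP eP; apply: card_meets => //.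
  by apply: contraNN eP => /BP ->.
move=> a a' Q aB aB' ne Qp aQ aQ'; have [<- //|PQ] := eqVneq P Q.
by case/eqP: ne; apply: (line_unique (Bp _ aB) (Bp _ aB') Pp Qp PQ (BP _ aB) aQ (BP _ aB') aQ').
Qed.

(** With [m] lines through a point, every other line adds at most [Q + 1 - m] points, for a total of
    [d Q + 1 - (d - m) (m - 1)]. The product is concave in [m] and takes its least value [2 (d - 3)]
    at both ends, [m = 3] and [m = d - 2]. *)
Lemma pencil_arith (N m d Q : nat) : (N <= m * Q + 1 + (d - m) * (Q.+1 - m))%N -> (3 <= m)%N ->
  (m.+2 <= d)%N -> (d <= Q)%N -> (N <= d * Q + 1 - 2 * (d - 3))%N.
Proof.
move=> h m3 md dQ; apply: leq_trans h _.
have [i em] : exists i, m = (i + 3)%N by exists (m - 3)%N; lia.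
have [j ed] : exists j, d = (m + j + 2)%N by exists (d - m.+2)%N; lia.
have [k eQ] : exists k, Q = (d + k)%N by exists (Q - d)%N; lia.
subst m d Q.
have -> : ((i + 3 + j + 2) - (i + 3) = j + 2)%N by lia.
have -> : ((i + 3 + j + 2 + k).+1 - (i + 3) = j + k + 3)%N by lia.
have -> : (2 * (i + 3 + j + 2 - 3) = 2 * (i + j + 2))%N by lia.
rewrite leq_subRL; first nia; nia.
Qed.

Lemma few_concurrent_arith (d Q : nat) : (5 <= d)%N -> (d <= Q)%N ->
  (Q.+1 + Q + (Q - 1) + (d - 3) * (Q - 2) <= d * Q + 1 - 2 * (d - 3))%N.
Proof.
move=> d5 dQ; have [i ed] : exists i, d = (i + 5)%N by exists (d - 5)%N; lia.
have [k eQ] : exists k, Q = (d + k)%N by exists (Q - d)%N; lia.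
subst d Q; have -> : (i + 5 - 3 = i + 2)%N by lia.
have -> : (i + 5 + k - 2 = i + k + 3)%N by lia.
rewrite leq_subRL; nia.
Qed.

Lemma count_concurrent s P a b c : uniq [:: a; b; c] -> {subset [:: a; b; c] <= s} ->
  dot a P = 0 -> dot b P = 0 -> dot c P = 0 -> (3 <= count (fun e => dot e P == 0%R) s)%N.
Proof.
move=> u sub aP bP cP; rewrite -size_filter; apply: (uniq_leq_size u) => e ein.
rewrite mem_filter sub // andbT; move: ein; rewrite !inE.
by case/or3P => /eqP ->; rewrite ?aP ?bP ?cP.
Qed.

Lemma triangle_arith (n1 n2 n3 n4 k Q : nat) : n1 = Q.+1 -> (n2 <= n1 + 1 * (Q.+1 - 1))%N ->
  (n3 <= n2 + 1 * (Q.+1 - 2))%N -> (n4 <= n3 + k * (Q.+1 - 3))%N ->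
  (n4 <= Q.+1 + Q + (Q - 1) + (k.+3 - 3) * (Q - 2))%N.
Proof. by rewrite -[k.+3]addn3 addnK !subSS; move: (k * _)%N => z; lia. Qed.

(** With no three lines concurrent, the first three add [q + 1], [q] and [q - 1] points, and every
    later line already shares three distinct points with those. *)
Lemma few_concurrent_bound s : uniq s -> {subset s <= points F} -> (5 <= size s)%N -> (size s <= q)%N ->
  (forall P, P \in points F -> (count (fun a => dot a P == 0%R) s <= 2)%N) ->
  (#|lines_union s| <= size s * q + 1 - 2 * (size s - 3))%N.
Proof.
move=> us sp s5 sq conc; apply: leq_trans (few_concurrent_arith s5 sq).
case: s us sp s5 sq conc => [|a [|b [|c s]]] // us sp s5 sq conc.
have step (B C : seq (vec3 F)) : B ++ C = [:: a, b, c & s] -> forall e, e \in C ->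
   (#|line e :\: lines_union B| <= q.+1 - size B)%N.
  move=> E e eC; have sub (x : vec3 F) : x \in B ++ C -> x \in points F by rewrite E; apply: sp.
  have eB : e \notin B.
    by move: us; rewrite -E cat_uniq => /and3P[_ /hasPn h _]; apply: h.
  apply: card_line_setD; first by apply/points_neq0/sub; rewrite mem_cat eC orbT.
  apply: card_meets => //.
  - by move=> x xB; apply: sub; rewrite mem_cat xB.
  - by move: us; rewrite -E cat_uniq => /andP[].
  - by apply: sub; rewrite mem_cat eC orbT.
  move=> x y Q xB yB xy Qp xQ yQ; apply/eqP => eQ.
  have := conc Q Qp; rewrite leqNgt => /negP[].
  apply: (@count_concurrent _ Q x y e) => //=.
    rewrite !inE negb_or xy andbT /=; apply/andP; split; by apply: contraNneq eB => <-.
  move=> z; rewrite -E mem_cat !inE => /or3P[] /eqP ->; rewrite ?xB ?yB ?eC ?orbT //.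
have h1 : #|lines_union [:: a]| = q.+1 by rewrite lines_union1 card_line // points_neq0 // sp ?mem_head.
have h2 : (#|lines_union ([:: a] ++ [:: b])| <= #|lines_union [:: a]| + 1 * (q.+1 - 1))%N.
  apply: (@card_lines_union_cat [:: a] [:: b]) => e eb.
  by apply: (step [:: a] [:: b, c & s]); rewrite // inE -mem_seq1 eb.
have h3 : (#|lines_union ([:: a; b] ++ [:: c])| <= #|lines_union [:: a; b]| + 1 * (q.+1 - 2))%N.
  apply: (@card_lines_union_cat [:: a; b] [:: c]) => e eb.
  by apply: (step [:: a; b] [:: c & s]); rewrite // inE -mem_seq1 eb.
have h4 : (#|lines_union ([:: a; b; c] ++ s)| <= #|lines_union [:: a; b; c]| + size s * (q.+1 - 3))%N.
  by apply: (@card_lines_union_cat [:: a; b; c] s) => e eb; apply: (step [:: a; b; c] s).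
exact: (triangle_arith h1 h2 h3 h4).
Qed.

Lemma lines_union_filter P s : lines_union s = lines_union (filter (fun a => dot a P == 0) s ++ filter (predC (fun a => dot a P == 0)) s).
Proof. by apply: eq_lines_union; apply: perm_mem; rewrite perm_sym perm_filterC. Qed.

(* The three largest values come from all, all but one, or all but two lines being concurrent. *)
Lemma arrangement_bound s : uniq s -> {subset s <= points F} -> (5 <= size s)%N -> (size s <= q)%N ->
  (#|lines_union s| < size s * q - size s + 3)%N -> (#|lines_union s| <= size s * q + 1 - 2 * (size s - 3))%N.
Proof.
move=> us sp s5 sq lt.
have [P0 P0p] : exists P, P \in points F by apply/card_gt0P; rewrite card_points addn1.
case: (arg_maxnP (fun P => count (fun a => dot a P == 0) s) P0p) => P Pp maxP.
have {}Pp : P \in points F := Pp.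
have [m3|m2] := leqP 3 (count (fun a => dot a P == 0) s); last first.
  apply: few_concurrent_bound => // Q Qp; apply: leq_trans (maxP Q Qp) _; exact: m2.
move: lt; rewrite (lines_union_filter P); set B := filter _ s; set C := filter (predC _) s => lt.
have sB : size B = count (fun a => dot a P == 0) s by rewrite size_filter.
have sC : size C = (size s - size B)%N by rewrite sB -(count_predC (fun a => dot a P == 0) s) addKn size_filter.
have Bs : (size B <= size s)%N by rewrite sB count_size.
have uB : uniq B by rewrite filter_uniq.
have Bp : {subset B <= points F} by move=> a; rewrite mem_filter => /andP[_ /sp].
have BP a : a \in B -> dot a P = 0 by rewrite mem_filter => /andP[/eqP].
have Cp a : a \in C -> a \in points F by rewrite mem_filter => /andP[_ /sp].
have CP a : a \in C -> dot a P != 0 by rewrite mem_filter => /andP[].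
have up : (#|lines_union (B ++ C)| <= #|lines_union B| + size C * (q.+1 - size B))%N.
  apply: card_lines_union_cat => e eC; apply: card_line_setD; first exact/points_neq0/Cp.
  by apply: (concurrent_meets Pp Bp uB) => //; [exact: Cp | exact: CP].
have LB : (#|lines_union B| <= size B * q + 1)%N.
  apply: card_lines_union; first by rewrite sB; apply: leq_trans m3.
  by apply/allP => a /Bp/points_neq0.
rewrite -sB in m3; rewrite sC in up.
have [md|md] := leqP (size B).+2 (size s).
  by apply: (pencil_arith _ m3 md sq); apply: leq_trans up _; rewrite leq_add2r.
have PB : P |: lines_union B = lines_union B.
  apply/setUidPr; rewrite sub1set mem_lines_union Pp /=; apply/hasP.
  have : (0 < size B)%N by apply: leq_trans m3.
  by case: (B) BP => // a B' BP _; exists a; rewrite ?mem_head // BP ?mem_head.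
have low := card_concurrent Pp uB Bp BP; rewrite PB in low.
(* At most one line avoids [P]. With none the union has at least [d q + 1] points, with one at least
   [d q - d + 3]; both are excluded by the hypothesis. *)
case: C sC lt Cp CP {up} => [|e C] sC lt Cp CP.
  rewrite cats0 in lt; have e : size s = size B by move: sC Bs; rewrite /=; lia.
  by rewrite -e in low; move: lt low s5; move: #|lines_union B| (size s) => n d; nia.
exfalso; have sB1 : size s = (size B).+1 by move: sC md; rewrite /=; lia.
have : (#|lines_union B| + #|line e :\: lines_union B| <= #|lines_union (B ++ e :: C)|)%N.
  rewrite -cardsUI (_ : lines_union B :&: _ = set0) ?cards0 ?addn0; last first.
    by apply/setP => Q; rewrite in_setI in_setD in_set0; case: (Q \in lines_union B).
  apply: subset_leq_card; apply/subsetP => Q; rewrite in_setU in_setD !mem_lines_union mem_line has_cat /=.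
  by case: (Q \in points F) => //=; case: has => //=; case: (_ == 0).
rewrite cardsD card_line; last by apply/points_neq0/Cp/mem_head.
have : (#|line e :&: lines_union B| <= size B)%N.
  apply: card_meets_leq; first by apply/points_neq0/Cp/mem_head.
  move=> a aB; apply: points_cross; [exact: Bp | by apply/Cp/mem_head |].
  by apply: contraNneq (CP e (mem_head _ _)) => <-; rewrite BP.
move: lt low; rewrite sB1 in sq *; move: #|lines_union (_ ++ _)| #|lines_union B| #|line e :&: lines_union B| (size B) sq.
move=> n1 n2 n3 m; move: q => Q; nia.
Qed.

End Arrangements.

(** * The third largest value *)

Section Main.
Variable F : finFieldType.
Implicit Types (a b c e l u v w P Q R : vec3 F) (x y t : F) (f g h : {mpoly F[3]}) (s B : seq (vec3 F)).
Local Notation q := #|F|.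

Lemma line_decomposition d f : f != 0 -> f \is d.-homog -> exists s g,
  [/\ f = g * \prod_(a <- s) lform a, all (fun a => a != 0) s, (size s <= d)%N,
      g \is (d - size s).-homog & no_line g].
Proof.
elim: d f => [|d IH] f f0 fd.
  exists [::], f; rewrite big_nil mulr1 subn0; split=> // a a0 [c fc].
  have [d1 d10 [_ ha]] := @homog_factorl F 3 c (lform a) 0 ltac:(by rewrite -fc) ltac:(by rewrite -fc).
  by have := dhomog_uniq (lform_neq0 a0) ha (lform_homog a).
case: (classic (no_line f)) => [nl|]; first by exists [::], f; rewrite big_nil mulr1 subn0.
move=> nnl; have [a [a0 [c fc]]] : exists a, a != 0 /\ divides (lform a) f.
  by apply: NNPP => h; apply: nnl => a a0 da; apply: h; exists a.
rewrite fc in f0 fd; have [d1 d1d [hc ha]] := homog_factorl f0 fd.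
have c0 : c != 0 by move: f0; rewrite mulf_eq0 negb_or => /andP[].
have e1 := dhomog_uniq (lform_neq0 a0) ha (lform_homog a).
have ed : d1 = d by lia.
rewrite ed in hc; have [s [g [cE s0 sd gd nl]]] := IH c c0 hc.
exists (a :: s), g; rewrite /= a0 subSS; split=> //.
by rewrite fc cE big_cons; ring.
Qed.

Lemma split_arith (k d Q : nat) : (k < d)%N -> ((d - k - 1) * Q + 1 + (k * Q + 1) <= (d - 1) * Q + 2)%N.
Proof.
move=> kd; have -> : (d - 1 = (d - k - 1) + k)%N by lia.
by rewrite mulnDl; lia.
Qed.

Lemma third_bound d f : f != 0 -> f \is d.-homog -> (5 <= d)%N -> (d <= q)%N ->
  (#|zeros f| < d * q - d + 3)%N ->
  (#|zeros f| <= d * q + 1 - 2 * (d - 3))%N \/ (#|zeros f| <= (d - 1) * q + 2)%N.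
Proof.
move=> f0 fd d5 dq; have [s [g [fE s0 sd gd nl]]] := line_decomposition f0 fd.
have g0 : g != 0 by move: f0; rewrite fE mulf_eq0 negb_or => /andP[].
have zE : zeros f = zeros g :|: lines_union s by rewrite fE zerosM zeros_prod_lines.
case: (posnP (size s)) => [/size0nil s_nil|s_gt0].
  have fg : f = g by rewrite fE s_nil big_nil mulr1.
  move=> _; right; have [dltq|qd] := ltnP d q.
    by apply: leq_trans (sziklai_bound f0 fd _ _ _) _; rewrite ?fg //; lia.
  have edq : d = q by apply/eqP; rewrite eqn_leq dq.
  by rewrite edq; apply: degree_q_bound; rewrite -?edq // fg.
have [sltd|ds] := ltnP (size s) d.
  move=> _; right; rewrite zE; apply: leq_trans (leq_card_setU _ _) _.
  have b1 := sziklai_bound g0 gd nl ltac:(by rewrite subn_gt0) ltac:(by apply: leq_trans dq; rewrite ltn_subrL s_gt0; lia).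
  have b2 := card_lines_union s_gt0 s0.
  apply: leq_trans (leq_add b1 b2) _.
  exact: split_arith.
have es : size s = d by apply/eqP; rewrite eqn_leq sd.
have zL : zeros f = lines_union s.
  by rewrite zE zeros_const ?set0U //; move: gd; rewrite es subnn.
rewrite zL -(lines_union_rep s) -(@eq_lines_union _ (undup (map (@rep F) s))); last by move=> a; rewrite mem_undup.
set s' := undup _.
have s'p : {subset s' <= points F}.
  by move=> a; rewrite mem_undup => /mapP[b /(allP s0) b0 ->]; apply: rep_point.
have s'd : (size s' <= d)%N by rewrite -es -(size_map (@rep F) s) size_undup.
(* Repeated components leave at most [d - 1] distinct lines, hence at most [(d - 1) q + 1]
   points. *)
have [lt|ge] := ltnP (size s') d; last first.
  have e' : size s' = d by apply/eqP; rewrite eqn_leq s'd.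
  by move=> h; left; have := @arrangement_bound F s'; rewrite e'; apply; rewrite ?undup_uniq.
move=> _; right; have s'_gt0 : (0 < size s')%N.
  have [a as_] : exists a, a \in s by case: (s) s_gt0 => // a r _; exists a; rewrite mem_head.
  have : rep a \in s' by rewrite mem_undup map_f.
  by case: (s').
have s'0 : all (fun a => a != 0) s' by apply/allP => a /s'p/points_neq0.
apply: leq_trans (card_lines_union s'_gt0 s'0) _; rewrite [X in (_ <= X)%N]addnS ltnW // ltnS leq_add2r leq_mul2r.
by apply/orP; right; rewrite subn1 -ltnS prednK //; apply: leq_trans d5.
Qed.

Definition vec x y t : vec3 F := [ffun i : 'I_3 => [:: x; y; t]`_i].

Lemma dot_vec x y t v : dot (vec x y t) v = x * v i0 + y * v i1 + t * v i2.
Proof. by rewrite /dot sum3 !ffunE. Qed.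

Lemma dot_repl a v : (dot (rep a) v == 0) = (dot a v == 0).
Proof. by have [x x0 ->] := repE a; rewrite dot_scalel mulf_eq0 (negPf x0). Qed.

Lemma dot_repr a v : (dot a (rep v) == 0) = (dot a v == 0).
Proof. by rewrite dotC dot_repl dotC. Qed.

Lemma vec_neq0 x y t : [|| x != 0, y != 0 | t != 0] -> vec x y t != 0.
Proof.
apply: contraTneq => /ffunP v0; have := v0 i0; have := v0 i1; have := v0 i2.
by rewrite !ffunE /= => -> -> ->; rewrite eqxx.
Qed.

Lemma disjoint_card3 (T : finType) (A B C : {set T}) : A :&: B = set0 -> A :&: C = set0 -> B :&: C = set0 ->
  #|A :|: (B :|: C)| = (#|A| + #|B| + #|C|)%N.
Proof.
move=> AB AC BC; have := cardsUI A (B :|: C); have := cardsUI B C.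
by rewrite setIUr AB AC BC setU0 cards0 !addn0 => h ->; rewrite h addnA.
Qed.

Lemma extremal_arith (d Q : nat) : (5 <= d)%N -> (d <= Q)%N ->
  ((d - 2) * Q + 1 + (Q.+1 - (d - 2)) + (Q.+1 - (d - 2)) = d * Q + 1 - 2 * (d - 3))%N.
Proof.
move=> d5 dQ; have [i ed] : exists i, d = (i + 5)%N by exists (d - 5)%N; lia.
have [k eQ] : exists k, Q = (d + k)%N by exists (Q - d)%N; lia.
subst d Q; have -> : (i + 5 - 2 = i + 3)%N by lia.
have -> : (i + 5 - 3 = i + 2)%N by lia.
have -> : ((i + 5 + k).+1 - (i + 3) = k + 3)%N by lia.
by nia.
Qed.

(** The gap between the two sides is [d - 4]. *)
Lemma third_lt_second (d Q : nat) : (5 <= d)%N -> (d <= Q)%N ->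
  (d * Q + 1 - 2 * (d - 3) < d * Q - d + 3)%N.
Proof.
move=> d5 dQ; have : (5 * d <= d * Q)%N by rewrite mulnC leq_mul2l (leq_trans d5 dQ) orbT.
by move: (d * Q)%N => z; lia.
Qed.

Lemma small_degree_arith (d Q : nat) : (5 <= d)%N -> (d <= Q)%N -> (2 * d <= Q + 5)%N ->
  ((d - 1) * Q + 2 <= d * Q + 1 - 2 * (d - 3))%N.
Proof.
move=> d5 dQ h; have : (5 * Q <= d * Q)%N by rewrite leq_mul2r d5 orbT.
by rewrite mulnBl mul1n; move: (d * Q)%N => z; lia.
Qed.

Lemma large_degree_arith (d Q : nat) : (5 <= d)%N -> (d <= Q)%N -> (Q + 6 <= 2 * d)%N ->
  (d * Q + 1 - 2 * (d - 3) <= (d - 1) * Q + 2)%N.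
Proof.
move=> d5 dQ h; have : (5 * Q <= d * Q)%N by rewrite leq_mul2r d5 orbT.
by rewrite mulnBl mul1n; move: (d * Q)%N => z; lia.
Qed.

(* [d - 2] concurrent lines and two further lines meeting on one of them. *)
Lemma extremal_curve d : (5 <= d)%N -> (d <= q)%N -> exists f,
  [/\ f != 0, f \is d.-homog & #|zeros f| = (d * q + 1 - 2 * (d - 3))%N].
Proof.
(* With coordinates [X, Y, Z], the lines [X = x Y] for [x] in [xs] pass through [P = (0 : 0 : 1)],
   and the extra lines [Z = 0] and [X = Z] meet at [(0 : 1 : 0)]. Putting 0 first in [xs] ensures
   that [X = 0], which contains this point, is among the lines. *)
move=> d5 dq; pose xs := take (d - 2) (0 :: enum [set~ (0 : F)]).
have szx : size xs = (d - 2)%N.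
  rewrite size_takel //= -cardE cardsC1 prednK; last by rewrite (leq_trans _ dq) // (leq_trans _ d5).
  by apply: leq_trans dq; apply: leq_subr.
have ux : uniq xs by rewrite take_uniq //= mem_enum !inE eqxx enum_uniq.
have x0 : 0 \in xs.
  by rewrite /xs (_ : d - 2 = (d - 3).+1)%N ?mem_head //; lia.
pose P := rep (vec 0 0 1); pose B := [seq rep (vec 1 (- x) 0) | x <- xs].
pose e1 := rep (vec 0 0 1); pose e2 := rep (vec 1 0 (-1)).
have Pp : P \in points F by rewrite rep_point // vec_neq0 // oner_eq0 !orbT.
have e1p : e1 \in points F by rewrite rep_point // vec_neq0 // oner_eq0 !orbT.
have e2p : e2 \in points F by rewrite rep_point // vec_neq0 // oner_eq0.
have Bp : {subset B <= points F}.
  by move=> a /mapP[x _ ->]; rewrite rep_point // vec_neq0 // oner_eq0.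
have szB : size B = (d - 2)%N by rewrite size_map.
have uB : uniq B.
  (* The point [(x : 1 : 0)] lies on the line of parameter [x] and on no other. *)
  rewrite map_inj_uniq // => x y e; have := dot_repl (vec 1 (- x) 0) (vec x 1 0).
  rewrite e dot_repl !dot_vec !ffunE /= !mul1r !mul0r !addr0 !mulr1 subrr eqxx.
  by move/eqP/subr0_eq.
have BP a : a \in B -> dot a P = 0.
  move=> /mapP[x _ ->]; apply/eqP; rewrite dot_repl dot_repr dot_vec !ffunE /=.
  by rewrite !mulr0 mul0r !addr0.
have e1P : dot e1 P != 0.
  by rewrite dot_repl dot_repr dot_vec !ffunE /= !mul0r !add0r mul1r oner_eq0.
have e2P : dot e2 P != 0.
  by rewrite dot_repl dot_repr dot_vec !ffunE /= mulr0 mul0r !add0r mulr1 oppr_eq0 oner_eq0.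
have card_rest e : e \in points F -> dot e P != 0 -> #|line e :\: lines_union B| = (q.+1 - (d - 2))%N.
  move=> ep eP; rewrite cardsD card_line ?points_neq0 //; congr (_ - _)%N.
  apply/eqP; rewrite eqn_leq -szB (concurrent_meets Pp Bp uB ep BP eP) andbT.
  apply: card_meets_leq; first exact: points_neq0.
  move=> a aB; apply: points_cross => //; first exact: Bp.
  by apply: contraNneq eP => <-; rewrite BP.
have PB : P |: lines_union B = lines_union B.
  apply/setUidPr; rewrite sub1set mem_lines_union Pp /=; apply/hasP.
  have aB : rep (vec 1 (- 0) 0) \in B by apply: map_f.
  by exists (rep (vec 1 (- 0) 0)); rewrite // BP.
have cB : #|lines_union B| = ((d - 2) * q + 1)%N.
  apply/eqP; rewrite eqn_leq -szB; have := card_concurrent Pp uB Bp BP; rewrite PB => ->.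
  rewrite andbT card_lines_union // ?szB ?subn_gt0 ?(leq_trans _ d5) //.
  by apply/allP => a /Bp/points_neq0.
exists (\prod_(a <- B ++ [:: e1; e2]) lform a); split.
- rewrite prodf_seq_neq0; apply/allP => a; rewrite mem_cat !inE implyTb => h; apply: lform_neq0.
  by apply: points_neq0; case/or3P: h => [/Bp //|/eqP ->|/eqP ->].
- have -> : d = size (B ++ [:: e1; e2]) by rewrite size_cat szB /= subnK // (leq_trans _ d5).
  exact: prod_lines_homog.
rewrite zeros_prod_lines -(extremal_arith d5 dq) -cB -{1}(card_rest e1 e1p e1P) -(card_rest e2 e2p e2P).
(* The extra lines meet only at a point already covered by [B], so their remaining points are
   disjoint and each contributes the full [q + 1 - (d - 2)]. *)
rewrite -disjoint_card3; last first.
- apply/setP => Q; rewrite in_setI !in_setD !mem_line mem_lines_union in_set0.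
  case: (Q \in points F); rewrite ?andbF //= dot_repl dot_vec mul0r mul0r add0r add0r mul1r.
  case: eqP => [Q2|]; rewrite ?andbF //= dot_repl dot_vec Q2 mulr0 mul0r !addr0 mul1r.
  case: eqP => [Q0|]; rewrite ?andbF //= !andbT andbb; apply/negbTE; rewrite negbK.
  apply/hasP; exists (rep (vec 1 (- 0) 0)); first exact: map_f.
  by rewrite dot_repl dot_vec Q0 oppr0 !mul0r mulr0 !addr0.
- by apply/setP => Q; rewrite in_setI in_setD in_set0; case: (Q \in lines_union B).
- by apply/setP => Q; rewrite in_setI in_setD in_set0; case: (Q \in lines_union B).
apply: eq_card => Q; rewrite !in_setU !in_setD !mem_lines_union !mem_line has_cat /=.
by case: (Q \in points F) => //=; case: has => //=; rewrite orbF.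
Qed.

End Main.

Theorem theorem4p4 (F : finFieldType) (d : nat) :
  (5 <= d)%N -> (d <= #|F|)%N ->
  ((2 * d <= #|F| + 5)%N -> is_N3 F d (d * #|F| + 1 - 2 * (d - 3))%N) /\
  ((#|F| + 6 <= 2 * d)%N ->
     forall f : {mpoly F[3]}, plane_curve d f ->
       (npoints f < d * #|F| - d + 3)%N -> (npoints f <= (d - 1) * #|F| + 2)%N).
Proof.
move=> d5 dq.
have both (f : {mpoly F[3]}) : plane_curve d f -> (npoints f < d * #|F| - d + 3)%N ->
    (npoints f <= d * #|F| + 1 - 2 * (d - 3))%N \/ (npoints f <= (d - 1) * #|F| + 2)%N.
  by move=> [f0 fd]; rewrite (npointsE fd); exact: (third_bound f0 fd d5 dq).
split=> h.
  split=> [|f fc lt].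
    have [f [f0 fd fN]] := extremal_curve d5 dq; exists f; rewrite (npointsE fd) fN; split=> //.
    by split=> //; apply: third_lt_second.
  by have [//|le] := both f fc lt; apply: leq_trans le (small_degree_arith _ _ _).
move=> f fc lt; have [le|//] := both f fc lt.
exact: leq_trans le (large_degree_arith _ _ _).
Qed.
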